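(* Let $\mathcal{C}'$ be a free conic-line arrangement in $\mathbb{P}^2$ (over $\mathbb{C}$) with exponents $(m_1,m_2)$ with $m_1\geq 2$. Let $Q$ be a smooth conic such that the intersection $Q\cap\mathcal{C}'$ consists of $2\deg\mathcal{C}'=2(m_1+m_2+1)$ points. Then the arrangement $\mathcal{C}=\mathcal{C}'\cup Q$ has type $2A$ with exponents $$(m_1+2,\ m_2+2,\ m_1+m_2+1).$$
   Context: A conic-line arrangement is a finite collection of distinct lines and smooth conics in $\mathbb{P}^2=\mathbb{P}^2_{\mathbb{C}}$, identified with the reduced curve given by their union; the number of conics is allowed to be zero (so line arrangements are included). Let $S=\mathbb{C}[x,y,z]$ with its standard grading. For a reduced curve $C:f=0$ of degree $d$ in $\mathbb{P}^2$, let $$D_0(f)=\{(a,b,c)\in S^3 : af_x+bf_y+cf_z=0\}$$ be the graded $S$-module of Jacobian syzygies, where a homogeneous element $(a,b,c)$ has degree $k$ if $a,b,c$ are homogeneous of degree $k$. Let $d_1\leq d_2\leq\dots\leq d_m$ be the degrees of the elements of a minimal system of homogeneous generators of $D_0(f)$; $(d_1,\dots,d_m)$ are the exponents of $C$. The curve is free if $D_0(f)$ is a free $S$-module; then $m=2$ and $d_1+d_2=d-1$. The type of $C$ is $t(C)=d_1+d_2+1-d$. A curve of type $2$ has $m=3$ or $m=4$; it is said to be of type $2A$ if $m=3$ and of type $2B$ if $m=4$. *)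

(* Defs.v *)
From mathcomp Require Import all_boot all_order all_algebra.
From mathcomp Require Import complex reals mpoly.

Set Implicit Arguments.
Unset Strict Implicit.
Unset Printing Implicit Defensive.

Import GRing.Theory.
Local Open Scope ring_scope.

(* Curves in P^2 are given by forms in S = K[x, y, z] = {mpoly K[3]}; S^3 is  *)
(* the module 'rV[{mpoly K[3]}]_3.                                            *)

(* Points of P^2: the lines through the origin of K^3. *)
Definition P2 (K : fieldType) : Type :=
  {L : {vspace 'rV[K]_3} | \dim L == 1%N}.

Section Curves.

Variable K : fieldType.

Implicit Types (f g : {mpoly K[3]}) (P : P2 K).

(* For homogeneous f of positive degree, vanishing on the whole line P is the *)
(* same as vanishing at one nonzero vector of it.                             *)
Definition on_curve f P : Prop :=
  forall v : 'rV[K]_3, v \in val P -> f.@[fun i => v 0 i] = 0.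

Definition same_curve f g : Prop := forall P, on_curve f P <-> on_curve g P.

Definition has_card (A : P2 K -> Prop) (n : nat) : Prop :=
  exists ps : seq (P2 K),
    [/\ uniq ps, size ps = n & forall P, P \in ps <-> A P].

Definition singular_point f P : Prop :=
  on_curve f P /\ forall i : 'I_3, on_curve f^`M(i) P.

Definition is_line f : Prop := f != 0 /\ f \is 1.-homog.

(* The zero form is excluded: all its points are singular. *)
Definition is_smooth_conic f : Prop :=
  f \is 2.-homog /\ forall P, ~ singular_point f P.

Definition conic_line_arrangement (s : seq {mpoly K[3]}) : Prop :=
  (forall g, g \in s -> is_line g \/ is_smooth_conic g) /\
  (forall i j : nat, (i < j < size s)%N -> ~ same_curve s`_i s`_j).

Definition equation (s : seq {mpoly K[3]}) : {mpoly K[3]} := \prod_(g <- s) g.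

(* msize is one more than the total degree. *)
Definition degree f : nat := (msize f).-1.

(* The module D_0(f). *)
Definition jacobian_syzygy f (a : 'rV[{mpoly K[3]}]_3) : Prop :=
  \sum_i a 0 i * f^`M(i) = 0.

Definition homogeneous_syzygy (k : nat) (a : 'rV[{mpoly K[3]}]_3) : Prop :=
  forall i, a 0 i \is k.-homog.

Definition lin_comb (r : seq 'rV[{mpoly K[3]}]_3)
    (c : 'I_(size r) -> {mpoly K[3]}) : 'rV[{mpoly K[3]}]_3 :=
  \sum_(j < size r) c j *: r`_j.

Definition generates (M : 'rV[{mpoly K[3]}]_3 -> Prop)
    (r : seq 'rV[{mpoly K[3]}]_3) : Prop :=
  (forall a, a \in r -> M a) /\
  (forall a, M a -> exists c, a = lin_comb (r := r) c).

Definition independent (r : seq 'rV[{mpoly K[3]}]_3) : Prop :=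
  forall c, lin_comb (r := r) c = 0 -> forall j, c j = 0.

Definition minimal_generators (M : 'rV[{mpoly K[3]}]_3 -> Prop)
    (r : seq 'rV[{mpoly K[3]}]_3) : Prop :=
  generates M r /\ forall r', subseq r' r -> generates M r' -> r' = r.

(* Finite bases suffice, since D_0(f) is finitely generated. *)
Definition free_curve f : Prop :=
  exists r, generates (jacobian_syzygy f) r /\ independent r.

(* A relation rather than a function: existence and uniqueness of the         *)
(* exponents are theorems. Members of a minimal system are nonzero, so their  *)
(* degrees are determined although 0 is homogeneous of every degree.          *)
Definition exponents f (ds : seq nat) : Prop :=
  sorted leq ds /\
  exists r : seq 'rV[{mpoly K[3]}]_3,
    [/\ minimal_generators (jacobian_syzygy f) r,
        size r = size ds &
        forall j, (j < size r)%N -> homogeneous_syzygy (nth 0%N ds j) r`_j].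

Definition has_type f (t : int) : Prop :=
  exists ds, [/\ exponents f ds, (1 < size ds)%N &
    t = (nth 0%N ds 0)%:Z + (nth 0%N ds 1)%:Z + 1 - (degree f)%:Z].

Definition type2A f : Prop :=
  has_type f 2 /\ exists2 ds, exponents f ds & size ds = 3%N.

End Curves.

(* Main.v *)
Require Import Defs.
From HB Require Import structures.
From mathcomp Require Import all_boot all_order all_algebra.
From mathcomp Require Import complex reals mpoly ring zify.

Set Implicit Arguments.
Unset Strict Implicit.
Unset Printing Implicit Defensive.

Import Order.TTheory GRing.Theory Num.Theory.
Local Open Scope ring_scope.

(** Let f be the equation of the given arrangement C', of degree d, let phi1
and phi2 be generators of D_0(f), of degrees m1 and m2, and let q be the
equation of Q. Vectors of forms are read as derivations: a sends p to the dot
product of a with the gradient of p. Put g1 = phi1(q) and g2 = phi2(q).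

Transversality. A smooth conic is parametrised by t |-> v0 + t v1 + t^2 v2,
where v2, the point at infinity, can be chosen off C'. Along it f becomes a
polynomial of degree at most 2d, which has the 2d intersection points as
distinct roots; so all its roots are simple ([simple_intersections]), and at
every point of Q the gradients of f and q are independent
([conic_transversal]): at a point of C' the derivative of f along Q would
vanish otherwise, at another point Euler's identity forbids it. The Koszul
derivations f_i d_j - f_j d_i kill f, so they are combinations of phi1 and
phi2, and they send q to the minors of the two gradients. Hence g1 and g2 have
no common zero on Q ([no_common_tangent]).

Sum of the exponents. The cross product of phi1 and phi2 is parallel to the
gradient of f. By the Koszul derivations again it vanishes only where the
gradient does, so neither vanishes on Q; two parallel vectors of polynomials
without common roots differ by a constant, and a comparison of degrees along Q
gives m1 + m2 = d - 1 ([exponents_sum]).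

Generators. Up to a multiple of the Euler field, a derivation killing q f is
a combination b phi1 + c phi2 tangent to Q, that is b g1 + c g2 is a multiple
of q. Since q, g1, g2 have no common zero, only the Koszul solutions
exist: (b, c) is a combination of (q, 0), (0, q) and (g2, - g1)
([koszul_mod_conic]). To see this concretely, the parametrisation embeds the
coordinate ring of the cone over Q in K[t][u], with image the polynomials whose
coefficient of u^k has degree at most 2k in t, and there the claim is Gauss's
lemma for the coprime polynomials g1(t), g2(t), together with a count of
degrees at infinity ([graded_syzygy]). This gives the three generators
[conic_lift] of phi1 and of phi2 and [koszul_field], of degrees m1 + 2, m2 + 2
and m1 + m2 + 1 ([generators_span]).

Minimality. All relations between the three generators are multiples of one
whose coefficients g2, g1, q vanish at the origin, so no generator is a
combination of the other two ([minimal_generators_conic]). *)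

(** * Forms: Euler's identity and the chain rule *)

Section Forms.

Variables (n : nat) (A : comNzRingType).
Implicit Types p : {mpoly A[n]}.

(** Identities between ring morphisms, or between derivations along one, need
only be checked on constants and variables. *)
Lemma mpoly_ring_ind (P : {mpoly A[n]} -> Prop) :
    (forall c, P c%:MP) -> (forall i, P 'X_i) ->
    (forall p r, P p -> P r -> P (p + r)) ->
    (forall p r, P p -> P r -> P (p * r)) ->
  forall p, P p.
Proof.
move=> PC PX PD PM p; rewrite [p]mpolyE.
apply: big_ind => [|//|m _]; first by rewrite -mpolyC0.
rewrite -mul_mpolyC mpolyXE_id; apply: (PM) => //.
apply: big_ind => [|//|i _]; first by rewrite -mpolyC1.
by elim: (m i) => [|k IHk]; rewrite ?expr0 -?mpolyC1 ?exprS //; apply: PM.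
Qed.

Lemma euler_identity k p :
  p \is k.-homog -> \sum_i 'X_i * p^`M(i) = p *+ k.
Proof.
move=> /dhomogP hp; rewrite {2}[p]mpolyE -sumrMnl.
under eq_bigr => i _.
  rewrite {1}[p]mpolyE raddf_sum mulr_sumr.
  over.
rewrite exchange_big /= [LHS]big_seq [RHS]big_seq; apply: eq_bigr => m /hp /= hm.
rewrite -hm mdegE -sumrMnr; apply: eq_bigr => i _.
rewrite mderivZ mderivX; case: (posnP (m i)) => [->|mi].
  by rewrite scale0r scaler0 mulr0 mulr0n.
rewrite -!scalerAr -mpolyXD addmC submK; last first.
  by apply/mnm_lepP => j; rewrite mnm1E; case: eqP => // <-.
by rewrite scalerA mulrC -scalerA scaler_nat.
Qed.

Lemma dhomog_mderiv k p i : p \is k.-homog -> p^`M(i) \is k.-1.-homog.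
Proof.
move=> /dhomogP hp; rewrite [p]mpolyE raddf_sum big_seq.
apply: rpred_sum => m /hp /= hm; rewrite mderivZ mderivX.
case: (posnP (m i)) => [->|mi]; first by rewrite scale0r scaler0 rpred0.
do 2![apply: dhomogZ]; rewrite dhomogX /= -hm.
have /submK {2}<- : (U_(i) <= m)%MM.
  by apply/mnm_lepP => j; rewrite mnm1E; case: eqP => // <-.
by rewrite mdegD mdeg1 addn1.
Qed.

Lemma deriv_mmap (x : 'I_n -> {poly A}) p :
  (mmap polyC x p)^`() = \sum_i mmap polyC x p^`M(i) * (x i)^`().
Proof.
elim/mpoly_ring_ind: p => [c|i|p r IHp IHr|p r IHp IHr].
- rewrite mmapC derivC big1 // => i _.
  by rewrite mderivC raddf0 mul0r.
- rewrite mmapX mmap1U (bigD1 i) //= mderivX big1 => [|j /negPf ji].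
    have -> : (U_(i) - U_(i) = 0 :> 'X_{1..n})%MM.
      by apply/mnmP => j; rewrite mnmBE subnn mnm0E.
    by rewrite mnm1E eqxx scale1r mpolyX0 rmorph1 mul1r addr0.
  by rewrite mderivX mnm1E eq_sym ji scale0r raddf0 mul0r.
- rewrite raddfD derivD IHp IHr -big_split /=; apply: eq_bigr => i _.
  by rewrite mderivD raddfD mulrDl.
- rewrite rmorphM derivM IHp IHr mulr_suml mulr_sumr -big_split /=.
  apply: eq_bigr => i _; rewrite mderivM raddfD /= !rmorphM /=; ring.
Qed.

End Forms.

(** * Restriction of forms to a parametrised conic *)

Notation i0 := (@Ordinal 3 0 isT).
Notation i1 := (@Ordinal 3 1 isT).
Notation i2 := (@Ordinal 3 2 isT).

Lemma all_ord3 (P : 'I_3 -> Prop) : P i0 -> P i1 -> P i2 -> forall i, P i.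
Proof.
by move=> p0 p1 p2 [[|[|[|//]]] h]; [move: p0|move: p1|move: p2];
  congr P; apply: val_inj.
Qed.

Lemma sum3 (A : nmodType) (F : 'I_3 -> A) : \sum_i F i = F i0 + F i1 + F i2.
Proof.
rewrite !big_ord_recl big_ord0 addr0 addrA.
by congr (F _ + F _ + F _); apply: val_inj.
Qed.

Lemma prod3 (A : comNzRingType) (F : 'I_3 -> A) : \prod_i F i = F i0 * F i1 * F i2.
Proof.
rewrite !big_ord_recl big_ord0 mulr1 mulrA.
by congr (F _ * F _ * F _); apply: val_inj.
Qed.

Lemma mdeg3 (m : 'X_{1..3}) : mdeg m = (m i0 + m i1 + m i2)%N.
Proof.
rewrite mdegE !big_ord_recl big_ord0 addn0 addnA.
by congr (m _ + m _ + m _)%N; apply: val_inj.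
Qed.

Section Conic.

Variable K : fieldType.
Implicit Types (b : {mpoly K[3]}) (V : 'M[K]_3).

(** The coefficient in the top allowed degree is multiplicative even when it
is zero: this is evaluation at the point at infinity. *)
Lemma size_coef_mul (p r : {poly K}) k l :
    (size p <= k.+1)%N -> (size r <= l.+1)%N ->
  (size (p * r)%R <= (k + l).+1)%N /\ (p * r)`_(k + l) = p`_k * r`_l.
Proof.
move=> hp hr; split.
  apply: leq_trans (size_polyMleq _ _) _.
  by rewrite -subn1 leq_subLR add1n -addnS -addSn leq_add.
have hk : (k < (k + l).+1)%N by rewrite ltnS leq_addr.
rewrite coefM (bigD1 (Ordinal hk)) //= addKn big1 ?addr0 // => i ik.
have [lt|ge] := ltnP i k.
  by rewrite [r`__]nth_default ?mulr0 //; apply: leq_trans hr _; lia.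
rewrite nth_default ?mul0r //; apply: leq_trans hp _.
by rewrite ltn_neqAle ge andbT eq_sym.
Qed.

Definition conic_coord V i : {poly K} :=
  (V i0 i)%:P + V i1 i *: 'X + V i2 i *: 'X^2.

Definition conic_point V (t : K) : 'rV[K]_3 :=
  row i0 V + t *: row i1 V + t ^+ 2 *: row i2 V.

Definition restr V : {mpoly K[3]} -> {poly K} := mmap (@polyC K) (conic_coord V).
HB.instance Definition _ V :=
  GRing.RMorphism.copy (restr V) (mmap (@polyC K) (conic_coord V)).

(** The variable u of {poly {poly K}} records degrees in x, y, z. With it
the kernel of the restriction is the ideal of the conic; [restr] alone also
kills inhomogeneous polynomials that take the value 0 on the chosen affine
curve. *)
Definition grestr V : {mpoly K[3]} -> {poly {poly K}} :=
  mmap (@polyC {poly K} \o @polyC K) (fun i => (conic_coord V i)%:P * 'X).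
HB.instance Definition _ V :=
  GRing.RMorphism.copy (grestr V)
    (mmap (@polyC {poly K} \o @polyC K) (fun i => (conic_coord V i)%:P * 'X)).

Lemma restrC V c : restr V c%:MP = c%:P.
Proof. exact: mmapC. Qed.

Lemma restrZ V c b : restr V (c *: b) = c *: restr V b.
Proof. by rewrite -mul_mpolyC rmorphM /= restrC mul_polyC. Qed.

Lemma restrU V i : restr V 'X_i = conic_coord V i.
Proof. by rewrite /restr mmapX mmap1U. Qed.

Lemma horner_conic_coord V i t : (conic_coord V i).[t] = conic_point V t 0 i.
Proof. by rewrite /conic_coord !hornerE !mxE /=; ring. Qed.

Lemma horner_restr V b t : (restr V b).[t] = b.@[conic_point V t 0].
Proof.
elim/mpoly_ring_ind: b => [c|i|p r IHp IHr|p r IHp IHr].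
- by rewrite restrC hornerC mevalC.
- by rewrite restrU mevalXU horner_conic_coord.
- by rewrite rmorphD hornerD IHp IHr mevalD.
- by rewrite rmorphM hornerM IHp IHr mevalM.
Qed.

Lemma restr_monomial V (m : 'X_{1..3}) :
  (size (restr V 'X_[m]) <= (2 * mdeg m).+1)%N /\
  (restr V 'X_[m])`_(2 * mdeg m) = 'X_[m].@[row i2 V 0].
Proof.
rewrite mevalX /restr mmapX /mmap1 mdegE big_distrr /=.
pose top (p : {poly K}) k c := (size p <= k.+1)%N /\ p`_k = c.
rewrite -/(top _ _ _); apply: (big_ind3 top).
- by rewrite /top size_poly1 coefC.
- move=> p k c r l e [p1 p2] [r1 r2].
  by have [h1 h2] := size_coef_mul p1 r1; rewrite /top h2 p2 r2.
- move=> i _; elim: (m i) => [|k [IH1 IH2]].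
    by rewrite /top muln0 !expr0 size_poly1 coefC.
  have hs : (size (conic_coord V i) <= 3)%N.
    rewrite /conic_coord; apply: leq_trans (size_polyD _ _) _.
    rewrite geq_max (leq_trans (size_scale_leq _ _)) ?size_polyXn //.
    rewrite (leq_trans (size_polyD _ _)) // geq_max size_polyC.
    by rewrite (leq_trans (size_scale_leq _ _)) ?size_polyX //; case: eqP.
  have [h1 h2] := size_coef_mul hs IH1.
  rewrite mulnS !exprS; split; first exact: h1.
  rewrite h2 IH2; congr (_ * _).
  by rewrite /conic_coord !coefE /= !mulr0 !add0r mulr1 mxE.
Qed.

(** Row 2 of V is the point of the conic at t = infinity, and the coefficient
of t^(2k) is the value there. *)
Lemma restr_dhomog V k b : b \is k.-homog ->
  (size (restr V b) <= (2 * k).+1)%N /\ (restr V b)`_(2 * k) = b.@[row i2 V 0].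
Proof.
move=> /dhomogP hb; rewrite [b]mpolyE !raddf_sum coef_sum big_seq; split.
  apply: (big_ind (fun p : {poly K} => size p <= (2 * k).+1)%N).
  - by rewrite size_poly0.
  - by move=> p r hp hr; rewrite (leq_trans (size_polyD _ _)) // geq_max hp hr.
  - move=> m /hb /= <-; rewrite restrZ (leq_trans (size_scale_leq _ _)) //.
    by case: (restr_monomial V m).
rewrite big_seq [RHS]big_seq; apply: eq_bigr => m /hb /= <-.
by rewrite restrZ mevalZ coefZ; case: (restr_monomial V m) => _ ->.
Qed.

Lemma grestrC V c : grestr V c%:MP = c%:P%:P.
Proof. exact: mmapC. Qed.

Lemma grestrZ V c b : grestr V (c *: b) = c%:P *: grestr V b.
Proof. by rewrite -mul_mpolyC rmorphM /= grestrC mul_polyC. Qed.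

Lemma grestr_monomial V (m : 'X_{1..3}) :
  grestr V 'X_[m] = (restr V 'X_[m])%:P * 'X^(mdeg m).
Proof.
rewrite /grestr /restr !mmapX /mmap1 mdegE expr_sum rmorph_prod -big_split /=.
by apply: eq_bigr => i _; rewrite exprMn rmorphXn.
Qed.

Lemma grestr_dhomog V k b :
  b \is k.-homog -> grestr V b = (restr V b)%:P * 'X^k.
Proof.
move=> /dhomogP hb; rewrite [b]mpolyE (raddf_sum (grestr V)) (raddf_sum (restr V)).
rewrite raddf_sum mulr_suml.
rewrite big_seq [RHS]big_seq; apply: eq_bigr => m /hb /= <-.
by rewrite grestrZ grestr_monomial restrZ -!mul_polyC polyCM mulrA.
Qed.

Lemma size_grestr_coef V b k : (size ((grestr V b)`_k)%R <= (2 * k).+1)%N.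
Proof.
rewrite [b]mpolyE (raddf_sum (grestr V)) coef_sum.
apply: (big_ind (fun p : {poly K} => size p <= (2 * k).+1)%N).
- by rewrite size_poly0.
- by move=> p r hp hr; rewrite (leq_trans (size_polyD _ _)) // geq_max hp hr.
- move=> m _ /=; rewrite grestrZ coefZ mul_polyC grestr_monomial coefCM coefXn.
  rewrite (leq_trans (size_scale_leq _ _)) //; case: eqP => [->|_].
    by rewrite mulr1; case: (restr_monomial V m).
  by rewrite mulr0 size_poly0.
Qed.

End Conic.

(** * The coordinate ring of the conic xz = y^2 *)

Section StandardConic.

Variable K : fieldType.
Implicit Types (b : {mpoly K[3]}) (P : {poly {poly K}}).

Definition std_conic : {mpoly K[3]} := 'X_i0 * 'X_i2 - 'X_i1 ^+ 2.

(** The monomial of degree k that restricts to t^j and has degree at most 1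
in y. These are normal forms modulo xz - y^2, one for each j <= 2k. *)
Definition std_monomial k j : {mpoly K[3]} :=
  'X_i0 ^+ (k - j./2 - odd j) * 'X_i1 ^+ odd j * 'X_i2 ^+ j./2.

(** A section of the restriction. The bound M makes it linear in P. *)
Definition std_lift M P : {mpoly K[3]} :=
  \sum_(k < M) \sum_(j < (2 * k).+1) P`_k`_j *: std_monomial k j.

Lemma dhomog_std_monomial k j :
  (j <= 2 * k)%N -> std_monomial k j \is k.-homog.
Proof.
move=> hj.
have X1 i : ('X_i : {mpoly K[3]}) \is 1.-homog by rewrite dhomogX /= mdeg1.
rewrite [X in X.-homog](_ : k = 1 * (k - j./2 - odd j) + 1 * odd j + 1 * j./2)%N;
  last by lia.
by do 2?[apply: dhomogM]; apply: dhomogMn.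
Qed.

Lemma restr_std_monomial k j : restr 1%:M (std_monomial k j) = 'X^j.
Proof.
rewrite !rmorphM !rmorphXn /= !restrU /conic_coord !mxE /=.
rewrite !(mulr1n, mulr0n, scale0r, scale1r, polyC0, polyC1, addr0, add0r).
rewrite expr1n mul1r -exprM -exprD; congr ('X^_); lia.
Qed.

Lemma grestr_std_monomial k j : (j <= 2 * k)%N ->
  grestr 1%:M (std_monomial k j) = 'X^j *: 'X^k.
Proof.
by move=> /dhomog_std_monomial /grestr_dhomog ->; rewrite restr_std_monomial mul_polyC.
Qed.

Lemma std_liftK M P :
    (size P <= M)%N -> (forall k, size (P`_k)%R <= (2 * k).+1)%N ->
  grestr 1%:M (std_lift M P) = P.
Proof.
move=> hP hPk; rewrite (raddf_sum (grestr 1%:M)) -[RHS](coefK P).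
rewrite poly_def (big_ord_widen M (fun k => P`_k *: 'X^k)) // [RHS]big_mkcond /=.
apply: eq_bigr => k _; rewrite (raddf_sum (grestr 1%:M)).
transitivity (P`_k *: 'X^k); last first.
  by case: ltnP => // /(nth_default 0) ->; rewrite scale0r.
transitivity (\sum_(j < (2 * k).+1) (P`_k`_j *: 'X^j) *: 'X^k : {poly {poly K}}).
  apply: eq_bigr => j _ /=; rewrite grestrZ grestr_std_monomial; last first.
    by rewrite -ltnS.
  by rewrite scalerA mul_polyC.
rewrite -scaler_suml; congr (_ *: _).
rewrite -[RHS](coefK P`_k) poly_def.
rewrite (big_ord_widen _ (fun j => P`_k`_j *: 'X^j) (hPk k)).
rewrite [RHS]big_mkcond /=; apply: eq_bigr => j _.
by case: ltnP => // /(nth_default 0) ->; rewrite scale0r.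
Qed.

Lemma std_liftD M P Q : std_lift M (P + Q) = std_lift M P + std_lift M Q.
Proof.
rewrite -big_split; apply: eq_bigr => k _; rewrite -big_split.
by apply: eq_bigr => j _ /=; rewrite !coefD scalerDl.
Qed.

Lemma std_liftZ M c P : std_lift M (c%:P *: P) = c *: std_lift M P.
Proof.
rewrite scaler_sumr; apply: eq_bigr => k _; rewrite scaler_sumr.
by apply: eq_bigr => j _; rewrite coefZ coefCM scalerA.
Qed.

Lemma std_lift_monomial M k j : (k < M)%N -> (j <= 2 * k)%N ->
  std_lift M ('X^j *: 'X^k) = std_monomial k j.
Proof.
move=> kM jk; rewrite /std_lift (bigD1 (Ordinal kM)) //= [X in _ + X]big1 ?addr0.
  rewrite -ltnS in jk; rewrite (bigD1 (Ordinal jk)) //= big1 ?addr0.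
    by rewrite coefZ !coefXn !eqxx mulr1 coefXn eqxx scale1r.
  move=> j' /eqP jj; rewrite coefZ !coefXn eqxx mulr1 coefXn.
  by case: eqP => [e|]; [case: jj; apply: val_inj|rewrite scale0r].
move=> k' /eqP kk; rewrite big1 // => j' _; rewrite coefZ coefXn.
case: eqP => [e|]; first by case: kk; apply: val_inj.
by rewrite mulr0 coef0 scale0r.
Qed.

(** Trading y^2 for xz changes neither the degree nor the restriction, so a
monomial reduces to the normal form with the same k and j. *)
Lemma monomial_mod_std_conic (m : 'X_{1..3}) : exists h,
  'X_[m] - std_monomial (mdeg m) (m i1 + 2 * m i2) = h * std_conic.
Proof.
have hodd : odd (m i1 + 2 * m i2) = odd (m i1) by lia.
have hhalf : ((m i1 + 2 * m i2)./2 = (m i1)./2 + m i2)%N by lia.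
rewrite mpolyXE_id prod3 /std_monomial hodd hhalf mdeg3.
have -> : (m i0 + m i1 + m i2 - ((m i1)./2 + m i2) - odd (m i1)
           = m i0 + (m i1)./2)%N by lia.
have -> : 'X_i1 ^+ m i1 =
    'X_i1 ^+ odd (m i1) * ('X_i1 ^+ 2) ^+ (m i1)./2 :> {mpoly K[3]}.
  by rewrite -exprM -exprD mul2n odd_double_half.
rewrite !exprD.
exists (- ('X_i0 ^+ m i0 * 'X_i1 ^+ odd (m i1) * 'X_i2 ^+ m i2 *
  (\sum_(i < (m i1)./2) ('X_i0 * 'X_i2) ^+ ((m i1)./2.-1 - i) * ('X_i1 ^+ 2) ^+ i))).
have := subrXX ('X_i0 * 'X_i2 : {mpoly K[3]}) ('X_i1 ^+ 2) (m i1)./2.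
rewrite -/std_conic exprMn.
set S := \sum_(i < _) _.
move: S => S; move: (m i0) (m i2) (odd _) (m i1)./2 => u v w z hS.
transitivity (- ('X_i0 ^+ u * 'X_i1 ^+ w * 'X_i2 ^+ v) * (std_conic * S)).
  by rewrite -hS; ring.
by ring.
Qed.

Lemma std_lift_mod M b : (msize b <= M)%N ->
  exists h, b - std_lift M (grestr 1%:M b) = h * std_conic.
Proof.
move=> hb; rewrite [b]mpolyE big_seq.
apply: (big_ind (fun b => exists h, b - std_lift M (grestr 1%:M b) = h * std_conic)).
- exists 0; rewrite rmorph0 mul0r sub0r /std_lift big1 ?oppr0 // => k _.
  by rewrite big1 // => j _; rewrite !coef0 scale0r.
- move=> p r [h eh] [h' eh']; exists (h + h').
  by rewrite rmorphD std_liftD mulrDl -eh -eh'; ring.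
- move=> m hm; have [h eh] := monomial_mod_std_conic m; exists (b@_m *: h).
  rewrite grestrZ std_liftZ -scalerAl -eh scalerBr.
  have -> : grestr 1%:M 'X_[m] = 'X^(m i1 + 2 * m i2) *: 'X^(mdeg m) :> {poly {poly K}}.
    rewrite grestr_monomial mul_polyC; congr (_ *: _).
    rewrite mpolyXE_id prod3 !rmorphM !rmorphXn /= !restrU /conic_coord !mxE /=.
    rewrite !(mulr1n, mulr0n, scale0r, scale1r, polyC0, polyC1, addr0, add0r).
    by rewrite expr1n mul1r -exprM -exprD.
  rewrite std_lift_monomial //; last by rewrite mdeg3; lia.
  exact: leq_trans (msize_mdeg_lt hm) hb.
Qed.

Lemma grestr_std_conic : grestr 1%:M std_conic = 0.
Proof.
rewrite (@grestr_dhomog _ _ 2).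
  rewrite rmorphB rmorphM rmorphXn /= !restrU /conic_coord !mxE /=.
  rewrite !(mulr1n, mulr0n, scale0r, scale1r, polyC0, polyC1, addr0, add0r).
  by rewrite mul1r subrr mul0r.
have X1 i : ('X_i : {mpoly K[3]}) \is 1.-homog by rewrite dhomogX /= mdeg1.
by rewrite rpredB // ?(@dhomogMn _ _ _ 1) ?(@dhomogM _ _ _ 1 _ 1).
Qed.

(** A polynomial is congruent to the lift of its restriction. *)
Lemma grestr_std_eq0 b : grestr 1%:M b = 0 -> exists h, b = h * std_conic.
Proof.
move=> e; have [h] := std_lift_mod (leqnn (msize b)).
rewrite e => eh; exists h; rewrite -eh /std_lift big1 ?subr0 // => k _.
by rewrite big1 // => j _; rewrite !coef0 scale0r.
Qed.

End StandardConic.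

(** * Smooth conics in adapted coordinates *)

Section Coordinates.

Variable K : fieldType.
Implicit Types (b q : {mpoly K[3]}) (V W : 'M[K]_3).

Definition mx_forms V := [tuple \sum_j V j i *: 'X_j | i < 3].

Definition mx_subst V : {mpoly K[3]} -> {mpoly K[3]} := comp_mpoly (mx_forms V).
HB.instance Definition _ V :=
  GRing.RMorphism.copy (mx_subst V) (comp_mpoly (mx_forms V)).

Lemma mx_substC V c : mx_subst V c%:MP = c%:MP.
Proof. exact: comp_mpolyC. Qed.

Lemma mx_substZ V c b : mx_subst V (c *: b) = c *: mx_subst V b.
Proof. exact: comp_mpolyZ. Qed.

Lemma mx_substU V i : mx_subst V 'X_i = \sum_j V j i *: 'X_j.
Proof. by rewrite /mx_subst comp_mpolyXU -tnth_nth tnth_mktuple. Qed.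

Lemma mx_subst_comp V W b : mx_subst V (mx_subst W b) = mx_subst (V *m W) b.
Proof.
elim/mpoly_ring_ind: b => [c|i|p r IHp IHr|p r IHp IHr].
- by rewrite !mx_substC.
- rewrite !mx_substU raddf_sum /=.
  under eq_bigr do rewrite mx_substZ mx_substU scaler_sumr.
  rewrite exchange_big /=; apply: eq_bigr => k _.
  rewrite mxE scaler_suml; apply: eq_bigr => j _.
  by rewrite scalerA mulrC.
- by rewrite !rmorphD /= IHp IHr.
- by rewrite !rmorphM /= IHp IHr.
Qed.

Lemma mx_subst1 b : mx_subst 1%:M b = b.
Proof.
elim/mpoly_ring_ind: b => [c|i|p r IHp IHr|p r IHp IHr].
- by rewrite !mx_substC.
- rewrite mx_substU (bigD1 i) //= big1 ?addr0 ?mxE ?eqxx ?scale1r // => j /negPf ji.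
  by rewrite mxE ji scale0r.
- by rewrite !rmorphD /= IHp IHr.
- by rewrite !rmorphM /= IHp IHr.
Qed.

Lemma mx_substK V : V \in unitmx -> cancel (mx_subst V) (mx_subst (invmx V)).
Proof. by move=> uV b; rewrite mx_subst_comp mulVmx // mx_subst1. Qed.

Lemma mx_substVK V : V \in unitmx -> cancel (mx_subst (invmx V)) (mx_subst V).
Proof. by move=> uV b; rewrite mx_subst_comp mulmxV // mx_subst1. Qed.

Lemma conic_coord_std V i :
  conic_coord V i = \sum_j V j i *: conic_coord 1%:M j.
Proof.
rewrite sum3 /conic_coord !mxE /=.
rewrite !(mulr1n, mulr0n, scale0r, scale1r, polyC0, polyC1, addr0, add0r).
by rewrite alg_polyC.
Qed.

Lemma grestr_subst V b : grestr V b = grestr 1%:M (mx_subst V b).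
Proof.
elim/mpoly_ring_ind: b => [c|i|p r IHp IHr|p r IHp IHr].
- by rewrite mx_substC !grestrC.
- rewrite mx_substU (raddf_sum (grestr 1%:M)) /=.
  rewrite {1}/grestr mmapX mmap1U conic_coord_std raddf_sum mulr_suml.
  apply: eq_bigr => j _; rewrite grestrZ {1}/grestr mmapX mmap1U /=.
  by rewrite -mul_polyC polyCM -mulrA mul_polyC.
- by rewrite !rmorphD /= IHp IHr.
- by rewrite !rmorphM /= IHp IHr.
Qed.

Lemma grestr_surj V (P : {poly {poly K}}) : V \in unitmx ->
    (forall k, size (P`_k)%R <= (2 * k).+1)%N ->
  exists b, grestr V b = P.
Proof.
move=> uV hP; exists (mx_subst (invmx V) (std_lift (size P) P)).
by rewrite grestr_subst mx_substVK // std_liftK.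
Qed.

(** In the coordinates given by the rows of V, the conic q becomes xz - y^2,
so that [conic_point V] parametrises it. *)
Definition adapted V q := V \in unitmx /\ mx_subst V q = std_conic K.

Lemma grestr_conic V q : adapted V q -> grestr V q = 0.
Proof. by case=> _ e; rewrite grestr_subst e grestr_std_conic. Qed.

Lemma grestr_eq0 V q b :
  adapted V q -> grestr V b = 0 -> exists h, b = h * q.
Proof.
move=> [uV e]; rewrite grestr_subst => /grestr_std_eq0[h].
rewrite -e => eb; exists (mx_subst (invmx V) h).
by rewrite -[LHS](mx_substK uV) eb rmorphM /= mx_substK.
Qed.

End Coordinates.

Section Points.

Variable K : fieldType.
Implicit Types (b q f : {mpoly K[3]}) (v : 'rV[K]_3).

Lemma meval_dhomogZ b k c v :
  b \is k.-homog -> b.@[(c *: v) 0] = c ^+ k * b.@[v 0].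
Proof.
move=> /dhomogP hb; rewrite !mevalE mulr_sumr big_seq [RHS]big_seq.
apply: eq_bigr => m /hb /= hm; rewrite [RHS]mulrCA; congr (_ * _).
rewrite -hm mdegE expr_sum -big_split /=.
by apply: eq_bigr => i _; rewrite mxE exprMn.
Qed.

Definition line_point v (nz : v != 0) : P2 K :=
  exist (fun L => \dim L == 1%N) <[v]>%VS
    (introT eqP (etrans (dim_vline v) (congr1 nat_of_bool nz))).

Lemma on_curve_line b k v (nz : v != 0) : (0 < k)%N -> b \is k.-homog ->
  on_curve b (line_point nz) <-> b.@[v 0] = 0.
Proof.
move=> k0 hb; split=> [|e w /= /vlineP[c ->]]; first by apply; apply: memv_line.
by rewrite (meval_dhomogZ c v hb) e mulr0.
Qed.

Lemma P2_line (P : P2 K) : exists v (nz : v != 0), P = line_point nz.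
Proof.
case: P => L hL; have nz : vpick L != 0.
  by rewrite vpick0 -dimv_eq0 (eqP hL).
exists (vpick L), nz; apply: val_inj => /=; apply/esym/eqP.
by rewrite eqEdim -memvE memv_pick dim_vline nz (eqP hL).
Qed.

End Points.

(** * Normal form of a smooth conic with a given point at infinity *)

Section NormalForm.

Variables (K : numClosedFieldType) (q : {mpoly K[3]}).
Hypothesis hq : q \is 2.-homog.

Definition hessian : 'M[K]_3 := \matrix_(i, j) (q^`M(i)^`M(j))@_0%MM.

Local Notation H := hessian.
Local Notation "u '*H' v" := (((u : 'rV[K]_3) *m H *m (v : 'rV[K]_3)^T) 0 0)
  (at level 40).

Lemma hessian_sym : H^T = H.
Proof. by apply/matrixP => i j; rewrite !mxE mderiv_comm. Qed.

Lemma dhomog0E (p : {mpoly K[3]}) : p \is 0.-homog -> p = (p@_0%MM)%:MP.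
Proof.
move=> /dhomogP hp; apply: msize1_polyC; rewrite msizeE.
by apply/bigmax_leqP_seq => m /hp /= ->.
Qed.

Lemma quadratic_deriv i : q^`M(i) = \sum_j H i j *: 'X_j.
Proof.
have := euler_identity (dhomog_mderiv i hq); rewrite mulr1n => <-.
apply: eq_bigr => j _; rewrite mxE mulrC -mul_mpolyC; congr (_ * _).
by apply: dhomog0E; apply: (@dhomog_mderiv _ _ 1); apply: (@dhomog_mderiv _ _ 2).
Qed.

Lemma quadratic_form (X := \row_i 'X_i : 'rV[{mpoly K[3]}]_3) :
  q *+ 2 = (X *m map_mx (@mpolyC 3 K) H *m X^T) 0 0.
Proof.
rewrite -(euler_identity hq) !mxE; under [RHS]eq_bigr => j _.
  rewrite !mxE mulr_suml.
  over.
rewrite /= exchange_big /=; apply: eq_bigr => i _.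
rewrite quadratic_deriv mulr_sumr; apply: eq_bigr => j _.
by rewrite !mxE -mul_mpolyC; ring.
Qed.

Lemma meval_quadratic_deriv i (v : 'rV[K]_3) : (q^`M(i)).@[v 0] = (v *m H) 0 i.
Proof.
rewrite quadratic_deriv raddf_sum mxE; apply: eq_bigr => j _ /=.
by rewrite mevalZ mevalXU mulrC -{1}hessian_sym mxE.
Qed.

Lemma meval_quadratic (v : 'rV[K]_3) : q.@[v 0] *+ 2 = v *H v.
Proof.
rewrite -mevalMn -(euler_identity hq) raddf_sum /= mxE.
apply: eq_bigr => i _; rewrite mevalM mevalXU meval_quadratic_deriv mulrC.
by rewrite [v^T _ _]mxE.
Qed.

Lemma hessian_comm (u v : 'rV[K]_3) : u *H v = v *H u.
Proof.
have -> : u *m H *m v^T = (v *m H *m u^T)^T.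
  by rewrite !trmx_mul trmxK hessian_sym mulmxA.
by rewrite [LHS]mxE.
Qed.

(** A vector in the radical of the polar form is a singular point. *)
Lemma hessian_unit :
  (forall v : 'rV[K]_3, v != 0 -> q.@[v 0] = 0 ->
      exists i, (q^`M(i)).@[v 0] != 0) ->
  H \in unitmx.
Proof.
move=> smooth; rewrite unitmxE unitfE; apply/negP => /det0P[v nz vH].
have [|i] := smooth v nz; last by rewrite meval_quadratic_deriv vH mxE eqxx.
apply/eqP; rewrite -[_ == _](mulrn_eq0 _ 2) meval_quadratic vH mul0mx mxE.
by rewrite eqxx.
Qed.

Lemma conic_point_exists : exists2 v : 'rV[K]_3, v != 0 & q.@[v 0] = 0.
Proof.
pose v t : 'rV[K]_3 := \row_i [:: 1; t; 0]`_i.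
pose e : 'rV[K]_3 := \row_i [:: 0; 1; 0]`_i.
have q0 (u : 'rV[K]_3) : u *H u = 0 -> q.@[u 0] = 0.
  by rewrite -meval_quadratic => /eqP; rewrite mulrn_eq0 => /eqP.
have form2 s t (M : 'M[K]_3) (w := \row_i [:: s; t; 0]`_i) :
    (w *m M *m w^T) 0 0 =
      s ^+ 2 * M i0 i0 + s * t * (M i0 i1 + M i1 i0) + t ^+ 2 * M i1 i1.
  rewrite !mxE sum3 !mxE !sum3 !mxE /=; ring.
have H10 : H i1 i0 = H i0 i1 by rewrite -{1}hessian_sym mxE.
have [h11|h11] := eqVneq (H i1 i1) 0.
  exists e.
    by apply/eqP => /rowP/(_ i1); rewrite !mxE /= => /eqP; rewrite oner_eq0.
  by apply: q0; rewrite form2 h11; ring.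
(* on the line z = 0 the form is quadratic in y / x, with discriminant D ^+ 2 *)
pose D := sqrtC (H i0 i1 ^+ 2 - H i0 i0 * H i1 i1).
have hD : D ^+ 2 = H i0 i1 ^+ 2 - H i0 i0 * H i1 i1 by rewrite sqrtCK.
exists (v ((D - H i0 i1) / H i1 i1)).
  by apply/eqP => /rowP/(_ i0); rewrite !mxE /= => /eqP; rewrite oner_eq0.
apply: q0; rewrite form2 H10.
transitivity ((D ^+ 2 - (H i0 i1 ^+ 2 - H i0 i0 * H i1 i1)) / H i1 i1).
  by field.
by rewrite hD subrr mul0r.
Qed.

(** A hyperbolic pair v0, v2 of isotropic vectors is completed by a vector v1
orthogonal to both, which the nondegeneracy of the form makes anisotropic. *)
Lemma adapted_exists (v0 : 'rV[K]_3) :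
    (forall v : 'rV[K]_3, v != 0 -> q.@[v 0] = 0 ->
      exists i, (q^`M(i)).@[v 0] != 0) ->
    v0 != 0 -> q.@[v0 0] = 0 ->
  exists2 V, adapted V q & row i2 V = v0.
Proof.
move=> smooth nz0 q0; have uH := hessian_unit smooth.
have B00 : v0 *H v0 = 0 by rewrite -meval_quadratic q0 mul0rn.
have BD (u w v : 'rV[K]_3) : (u + w) *H v = u *H v + w *H v by rewrite !mulmxDl mxE.
have BZ c (u v : 'rV[K]_3) : (c *: u) *H v = c * (u *H v) by rewrite -!scalemxAl mxE.
have BC := hessian_comm.
(* a second isotropic vector, paired to 1 with v0 *)
have [v2 B22 B02] : exists2 v2 : 'rV[K]_3, v2 *H v2 = 0 & v0 *H v2 = 1.
  have [i hi] : exists i, (v0 *m H) 0 i != 0.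
    by have [j] := smooth v0 nz0 q0; rewrite meval_quadratic_deriv; exists j.
  have [w B0w] : exists w : 'rV[K]_3, v0 *H w = 1.
    exists (((v0 *m H) 0 i)^-1 *: delta_mx 0 i).
    rewrite linearZ /= -scalemxAr trmx_delta -colE mxE [col _ _ _ _]mxE.
    by rewrite mulVf.
  have Bw0 : w *H v0 = 1 by rewrite BC.
  exists (w + (- (w *H w / 2)) *: v0).
    set z := w + _; have Bz u : z *H u = w *H u - w *H w / 2 * (v0 *H u).
      by rewrite /z BD BZ mulNr.
    by rewrite Bz [w *H z]BC [v0 *H z]BC !Bz B00 B0w Bw0; field.
  by rewrite BC BD BZ Bw0 B00 mulr0 addr0.
(* a third vector, orthogonal to both *)
have [v1 nz1 [B10 B12]] : exists2 v1 : 'rV[K]_3, v1 != 0 &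
    v1 *H v0 = 0 /\ v1 *H v2 = 0.
  pose N := H *m (col_mx v0 v2)^T.
  have : kermx N != 0.
    rewrite kermx_eq0 /row_free; apply/eqP => rk.
    by have := rank_leq_col N; rewrite rk.
  case/rowV0Pn => v1 /sub_kermxP kv nz; exists v1 => //.
  move: kv; rewrite /N mulmxA tr_col_mx mul_mx_row => /eqP.
  rewrite row_mx_eq0 => /andP[/eqP-> /eqP->]; by rewrite !mxE.
pose V c : 'M[K]_3 := \matrix_(k, j) ([:: v2; c *: v1; v0]`_k 0 j).
have rV c k : row k (V c) = [:: v2; c *: v1; v0]`_k.
  by apply/rowP => j; rewrite !mxE.
have uV c : c != 0 -> V c \in unitmx.
  move=> nzc; rewrite unitmxE unitfE; apply/negP => /det0P[u nz].
  rewrite mulmx_sum_row sum3 !rV /= => e.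
  have B20 : v2 *H v0 = 1 by rewrite BC.
  have B u' : (u 0 i0 *: v2 + u 0 i1 *: (c *: v1) + u 0 i2 *: v0) *H u' = 0.
    by rewrite e !mul0mx mxE.
  have := B v0; rewrite !BD !BZ B20 B10 B00 !mulr0 !addr0 mulr1 => u0.
  have := B v2; rewrite !BD !BZ B22 B12 B02 !mulr0 !add0r mulr1 => u2.
  move: e; rewrite u0 u2 !scale0r add0r addr0 scalerA => /eqP.
  rewrite scaler_eq0 (negPf nz1) orbF mulf_eq0 (negPf nzc) orbF => /eqP u1.
  case/negP: nz; apply/eqP/rowP => i; rewrite mxE.
  by elim/all_ord3: i.
(* the Gram matrix of the rows of V c *)
have BVE c i j : (V c *m H *m (V c)^T) i j = row i (V c) *H row j (V c).
  by rewrite tr_row colE mulmxA -!row_mul -colE !mxE.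
have B11 : v1 *H v1 != 0.
  have := uV 1 (oner_neq0 _) => u1; apply/eqP => B11.
  have : V 1 *m H *m (V 1)^T \in unitmx by rewrite !unitmx_mul unitmx_tr u1 uH.
  rewrite unitmxE unitfE => /negP; apply; apply/det0P.
  exists (delta_mx 0 i1).
    by apply/eqP => /rowP/(_ i1); rewrite !mxE !eqxx => /eqP; rewrite oner_eq0.
  rewrite -rowE; apply/rowP => j; rewrite mxE BVE [RHS]mxE !rV /= scale1r.
  by elim/all_ord3: j => /=; rewrite ?scale1r.
(* q takes the value -1 at c v1, where its polar form takes the value -2 *)
pose c := sqrtC (- 2 / (v1 *H v1)).
have c2 : c * (c * (v1 *H v1)) = - 2.
  by rewrite mulrA -expr2 sqrtCK mulfVK.
have nzc : c != 0.
  apply/eqP => c0; move/eqP: c2; rewrite c0 mul0r eq_sym oppr_eq0.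
  by rewrite pnatr_eq0.
exists (V c); last by rewrite rV.
split; first exact: uV.
have two : 2 != 0 :> K by rewrite pnatr_eq0.
apply: (scalerI two); rewrite -mx_substZ scaler_nat quadratic_form.
pose X : 'rV[{mpoly K[3]}]_3 := \row_i 'X_i.
have hX M (k := map_mx (@mpolyC 3 K) M) :
  mx_subst (V c) ((X *m k *m X^T) 0 0) =
  (X *m map_mx (@mpolyC 3 K) (V c *m M *m (V c)^T) *m X^T) 0 0.
  have lX : map_mx (mx_subst (V c)) X = X *m map_mx (@mpolyC 3 K) (V c).
    apply/rowP => i; rewrite !mxE mx_substU; apply: eq_bigr => j _.
    by rewrite !mxE -mul_mpolyC mulrC.
  have -> : mx_subst (V c) ((X *m k *m X^T) 0 0) =
      (map_mx (mx_subst (V c)) (X *m k *m X^T)) 0 0 by rewrite [RHS]mxE.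
  have hk : map_mx (mx_subst (V c)) k = k.
    by apply/matrixP => i j; rewrite !mxE mx_substC.
  by rewrite !map_mxM /= -!map_trmx lX hk trmx_mul !mulmxA.
rewrite hX.
have -> : V c *m H *m (V c)^T =
    \matrix_(i, j)
      (nth [::] [:: [:: 0; 0; 1]; [:: 0; -2; 0]; [:: 1; 0; 0]] i)`_j :> 'M[K]_3.
  have B20 : v2 *H v0 = 1 by rewrite BC.
  have B01 : v0 *H v1 = 0 by rewrite BC.
  have B21 : v2 *H v1 = 0 by rewrite BC.
  apply/matrixP => i j; rewrite BVE [RHS]mxE !rV.
  elim/all_ord3: i; elim/all_ord3: j => //=.
  - by rewrite BC BZ B12 mulr0.
  - by rewrite BZ B12 mulr0.
  - by rewrite BZ BC BZ c2.
  - by rewrite BZ B10 mulr0.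
  - by rewrite BC BZ B10 mulr0.
rewrite !mxE sum3 !mxE !sum3 !mxE /=.
rewrite !(mpolyC0, mpolyC1, mpolyCN, mpolyC_nat) scaler_nat /std_conic; ring.
Qed.

End NormalForm.

(** * Intersection points and transversality *)

Section ConicPoints.

Variable K : fieldType.
Implicit Types (b q f : {mpoly K[3]}) (v : 'rV[K]_3) (V : 'M[K]_3).

Lemma conic_pointE V t : conic_point V t = (\row_i t ^+ i) *m V.
Proof.
apply/rowP => j; rewrite !mxE sum3 !mxE /=.
by rewrite expr0 expr1 mul1r.
Qed.

Lemma conic_point_nz V t : V \in unitmx -> conic_point V t != 0.
Proof.
move=> uV; apply/eqP; rewrite conic_pointE => /(congr1 (mulmxr (invmx V))) /=.
rewrite mulmxK // mul0mx => /rowP/(_ i0); rewrite !mxE expr0 => /eqP.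
by rewrite oner_eq0.
Qed.

Lemma conic_point_inj V s t c : V \in unitmx ->
  conic_point V s = c *: conic_point V t -> s = t.
Proof.
move=> uV; rewrite !conic_pointE scalemxAl => /(congr1 (mulmxr (invmx V))) /=.
rewrite !mulmxK // => /rowP e; have := e i1; have := e i0; rewrite !mxE /=.
by rewrite !expr0 !expr1 mulr1 => <- ->; rewrite mul1r.
Qed.

Lemma meval_mx_subst V b v : (mx_subst V b).@[v 0] = b.@[(v *m V) 0].
Proof.
elim/mpoly_ring_ind: b => [c|i|p r IHp IHr|p r IHp IHr].
- by rewrite mx_substC !mevalC.
- rewrite mx_substU mevalXU raddf_sum mxE; apply: eq_bigr => j _ /=.
  by rewrite mevalZ mevalXU mulrC.
- by rewrite rmorphD !mevalD IHp IHr.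
- by rewrite rmorphM !mevalM IHp IHr.
Qed.

Lemma conic_points V q v : adapted V q -> v != 0 -> q.@[v 0] = 0 ->
  (exists c, v = c *: row i2 V) \/ (exists c t, c != 0 /\ v = c *: conic_point V t).
Proof.
move=> [uV e] nz; rewrite -[v](mulmxKV uV) -meval_mx_subst e.
set x := v *m invmx V; rewrite mevalB mevalM rmorphXn /= !mevalXU => /eqP.
rewrite subr_eq0 => /eqP hx; have [x0|x0] := eqVneq (x 0 i0) 0; [left|right].
  exists (x 0 i2); rewrite mulmx_sum_row sum3 x0.
  have /eqP : x 0 i1 ^+ 2 = 0 by rewrite -hx x0 mul0r.
  by rewrite expf_eq0 /= => /eqP->; rewrite !scale0r !add0r.
exists (x 0 i0), (x 0 i1 / x 0 i0); split=> //.
rewrite mulmx_sum_row sum3 /conic_point !scalerDr !scalerA.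
congr (_ + _ *: _ + _ *: _); first by rewrite mulrC divfK.
by rewrite expr_div_n -hx; field.
Qed.

Lemma restr_conic V q : q \is 2.-homog -> adapted V q -> restr V q = 0.
Proof.
move=> hq /grestr_conic; rewrite (grestr_dhomog _ hq) => /eqP.
by rewrite mulf_eq0 polyC_eq0 expf_eq0 polyX_eq0 andbF orbF => /eqP.
Qed.

Lemma meval_conic_point V q t : q \is 2.-homog -> adapted V q ->
  q.@[conic_point V t 0] = 0.
Proof.
by move=> hq aV; rewrite -horner_restr restr_conic // horner0.
Qed.

Lemma seq_preimage (T T' : eqType) (g : T -> T') (s : seq T') :
  (forall y, y \in s -> exists x, y = g x) -> exists r, s = map g r.
Proof.
elim: s => [|y s IH] h; first by exists [::].
have [|r ->] := IH; first by move=> z zs; apply: h; rewrite inE zs orbT.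
by have [x ->] := h y (mem_head _ _); exists (x :: r).
Qed.

(** If t were a double root, all of ts would be roots of p / (X - t), whose
degree is less than the length of ts. *)
Lemma simple_roots (p : {poly K}) (ts : seq K) t : p != 0 ->
    uniq ts -> (forall s, s \in ts -> root p s) ->
    (size p <= (size ts).+1)%N ->
  root p t -> p^`().[t] != 0.
Proof.
move=> nz uts hts sz rt; apply/eqP => dt.
have [r er] := factor_theorem _ _ rt.
have nzr : r != 0 by apply: contra_neq nz => r0; rewrite er r0 mul0r.
have rr : r.[t] = 0.
  move: dt; rewrite er derivM derivXsubC !hornerE /= subrr mulr0 add0r.
  by rewrite ?mulr1.
have : (size ts < size r)%N.
  apply: max_poly_roots => //; apply/allP => s /hts; rewrite er rootM root_XsubC.
  by case/orP => // /eqP ->; apply/rootP.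
move: sz; rewrite er size_Mmonic ?monicXsubC // size_XsubC addn2 /= ltnS => le.
by rewrite ltnNge le.
Qed.

End ConicPoints.

Section Intersection.

Variable K : numClosedFieldType.
Implicit Types (b q f : {mpoly K[3]}) (v : 'rV[K]_3) (V : 'M[K]_3).

Lemma smooth_conic_deriv q v : is_smooth_conic q -> v != 0 -> q.@[v 0] = 0 ->
  exists i, (q^`M(i)).@[v 0] != 0.
Proof.
move=> [hq sm] nz q0.
have [/existsP[i hi]|/existsPn h] :=
  boolP [exists i, (q^`M(i)).@[v 0] != 0]; first by exists i.
case: (sm (line_point nz)); split; first exact/(on_curve_line nz _ hq).
move=> i; apply/(on_curve_line nz _ (dhomog_mderiv i hq)) => //.
by apply/eqP; rewrite -[_ == _]negbK.
Qed.

Lemma smooth_conic_neq0 q : is_smooth_conic q -> q != 0.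
Proof.
move=> sq; have nz : const_mx 1 != 0 :> 'rV[K]_3.
  by apply/eqP => /rowP/(_ i0); rewrite !mxE => /eqP; rewrite oner_eq0.
apply/eqP => q0; have [|i] := smooth_conic_deriv sq nz.
  by rewrite q0 meval0.
by rewrite q0 mderiv0 meval0 eqxx.
Qed.

(** Otherwise the conic, which has infinitely many points, would lie on the
curve f. *)
Lemma has_card_restr_neq0 V q f d n :
    is_smooth_conic q -> adapted V q -> f \is d.-homog -> (0 < d)%N ->
    has_card (fun P => on_curve q P /\ on_curve f P) n ->
  restr V f != 0.
Proof.
move=> [hq _] aV hf d0 [ps [_ _ hps]]; apply/eqP => f0.
have uV := aV.1.
pose pt t := line_point (conic_point_nz t uV).
have pt_inj : injective pt.
  move=> s t /(congr1 val) /= e; have : conic_point V s \in <[conic_point V t]>%VS.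
    by rewrite -e memv_line.
  by case/vlineP => c /(conic_point_inj uV).
pose ts : seq K := [seq i%:R | i <- iota 0 (size ps).+1].
have uts : uniq (map pt ts).
  rewrite map_inj_uniq // map_inj_uniq ?iota_uniq //.
  by move=> i j /eqP; rewrite eqr_nat => /eqP.
have := @uniq_leq_size _ _ ps uts; rewrite !size_map size_iota ltnn => absurd.
suff : false by [].
apply: absurd => P /mapP[t _ ->]; apply/hps; split.
  by apply/(on_curve_line _ _ hq) => //; apply: meval_conic_point.
by apply/(on_curve_line _ d0 hf); rewrite -horner_restr f0 horner0.
Qed.

Lemma conic_point_off q f d n :
    is_smooth_conic q -> f \is d.-homog -> (0 < d)%N ->
    has_card (fun P => on_curve q P /\ on_curve f P) n ->
  exists v, [/\ v != 0, q.@[v 0] = 0 & f.@[v 0] != 0].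
Proof.
move=> sq hf d0 hc; have hq := sq.1.
have [v0 nz0 q0] := conic_point_exists hq.
have [V aV _] := adapted_exists hq (fun v => @smooth_conic_deriv q v sq) nz0 q0.
have nzf := has_card_restr_neq0 sq aV hf d0 hc.
have [t ft] : exists t, ~~ root (restr V f) t.
  pose ts : seq K := [seq i%:R | i <- iota 0 (size (restr V f))].
  have [/allP h|/allPn[t _ ht]] := boolP (all (root (restr V f)) ts); last by exists t.
  have := @max_poly_roots _ (restr V f) ts nzf; rewrite size_map size_iota ltnn => absurd.
  suff : false by [].
  apply: absurd; first exact/allP.
  by rewrite map_inj_uniq ?iota_uniq // => i j /eqP; rewrite eqr_nat => /eqP.
exists (conic_point V t); split; first exact: conic_point_nz aV.1.
  exact: meval_conic_point.
by rewrite -horner_restr.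
Qed.

(** No intersection point is at infinity, so the 2d points give 2d distinct
roots of a nonzero polynomial of degree at most 2d. *)
Lemma simple_intersections V q f d t :
    is_smooth_conic q -> adapted V q -> f \is d.-homog -> (0 < d)%N ->
    has_card (fun P => on_curve q P /\ on_curve f P) (2 * d) ->
    f.@[row i2 V 0] != 0 ->
  root (restr V f) t -> (restr V f)^`().[t] != 0.
Proof.
move=> sq aV hf d0 hc foff; have nzf := has_card_restr_neq0 sq aV hf d0 hc.
have hq := sq.1; have [ps [ups szps hps]] := hc; have uV := aV.1.
pose pt t := line_point (conic_point_nz t uV).
have [ts ets] : exists ts, ps = map pt ts.
  apply: seq_preimage => P; have [v [nz ->]] := P2_line P.
  move=> /hps [/(on_curve_line _ _ hq)-/(_ isT) qv /(on_curve_line _ d0 hf) fv].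
  have [[c ev]|[c [s [nzc ev]]]] := conic_points aV nz qv.
    have /eqP := fv; rewrite {1}ev (meval_dhomogZ _ _ hf).
    rewrite mulf_eq0 (negPf foff) orbF expf_eq0 d0 /= => /eqP c0.
    by case/negP: (nz); rewrite ev c0 scale0r.
  exists s; apply: val_inj => /=; apply/eqP; rewrite eqEdim -memvE ev.
  rewrite memvZ ?memv_line // !dim_vline conic_point_nz // scaler_eq0 negb_or nzc.
  by rewrite conic_point_nz.
have rts s : (s \in ts) = root (restr V f) s.
  apply/idP/idP => [|rs].
    move=> /(map_f pt); rewrite -ets => /hps[_ /(on_curve_line _ d0 hf)].
    by rewrite -horner_restr => /rootP.
  have : pt s \in ps.
    apply/hps; split; first by apply/(on_curve_line _ _ hq) => //; apply: meval_conic_point.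
    by apply/(on_curve_line _ d0 hf); rewrite -horner_restr; apply/rootP.
  rewrite ets => /mapP[s' s'ts /(congr1 val) /= e].
  have : conic_point V s \in <[conic_point V s']>%VS by rewrite -e memv_line.
  by case/vlineP => c /(conic_point_inj uV) ->.
apply: (@simple_roots _ _ ts) => //.
- by move: ups; rewrite ets => /map_uniq.
- by move=> s; rewrite rts.
- by move: szps; rewrite ets size_map => ->; case: (restr_dhomog V hf).
Qed.

End Intersection.

(** * Syzygies modulo the ideal of a smooth conic *)

Section Syzygies.

Variable K : numClosedFieldType.
Implicit Types (b q f : {mpoly K[3]}) (v : 'rV[K]_3) (V : 'M[K]_3).

(** The form of degree n from which p comes does not vanish at infinity. *)
Definition full_size (p : {poly K}) n := size p = (2 * n).+1.

Lemma restr_full_size V n b : b \is n.-homog -> b.@[row i2 V 0] != 0 ->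
  full_size (restr V b) n.
Proof.
move=> hb nz; have [sz co] := restr_dhomog V hb; apply/eqP.
rewrite /full_size eqn_leq sz ltnNge; apply/negP => /leq_sizeP/(_ _ (leqnn _)) c0.
by case/eqP: nz; rewrite -c0 co.
Qed.

(** Compare coefficients of powers of u: Gauss's lemma divides those of B by
G2, and the one of G1, G2 that does not vanish at infinity bounds the degrees
of the quotients. *)
Lemma graded_syzygy (G1 G2 : {poly K}) n1 n2 (B C : {poly {poly K}}) :
    coprimep G1 G2 -> G2 != 0 ->
    full_size G1 n1 \/ full_size G2 n2 ->
    (forall k, size (B`_k)%R <= (2 * k).+1)%N ->
    (forall k, size (C`_k)%R <= (2 * k).+1)%N ->
    B * (G1%:P * 'X^n1) + C * (G2%:P * 'X^n2) = 0 ->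
  exists H : {poly {poly K}},
    [/\ forall k, (size (H`_k)%R <= (2 * k).+1)%N,
        B = H * (G2%:P * 'X^n2) & C = - H * (G1%:P * 'X^n1)].
Proof.
move=> cop nz2 full hB hC e.
have eN N : (if (N < n1)%N then 0 else B`_(N - n1) * G1) +
            (if (N < n2)%N then 0 else C`_(N - n2) * G2) = 0.
  have := congr1 (fun p : {poly {poly K}} => p`_N) e.
  by rewrite coefD !mulrA !coefMXn !coefMC coef0.
pose D j : {poly K} := B`_j %/ G2.
have DE j : B`_j = D j * G2.
  rewrite divpK // -(@Gauss_dvdpl _ _ G1) 1?coprimep_sym //.
  have := eN (j + n1)%N; rewrite ltnNge leq_addl /= addnK => /eqP.
  rewrite addr_eq0 => /eqP ->; rewrite dvdpNr.
  by case: ifP => _; rewrite ?dvdp0 ?dvdp_mull.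
have Dsz j : D j != 0 -> (size (D j) + 2 * n2 <= (2 * j).+1)%N.
  move=> nzD; have szD : (0 < size (D j))%N by rewrite size_poly_gt0.
  case: full => [f1|f2].
    have nz1 : G1 != 0 by rewrite -size_poly_gt0 f1.
    have := eN (j + n1)%N; rewrite ltnNge leq_addl /= addnK DE.
    case: ltnP => h.
      by move/eqP; rewrite addr0 !mulf_eq0 (negPf nzD) (negPf nz1) (negPf nz2).
    rewrite mulrAC -mulrDl => /eqP; rewrite mulf_eq0 (negPf nz2) orbF.
    rewrite addr_eq0 => /eqP eD; have := hC (j + n1 - n2)%N.
    rewrite -size_polyN -eD size_mul // f1.
    by move: h szD; move: (size (D j)) => s; clear; lia.
  by have := hB j; rewrite DE size_mul // f2;
    move: szD; move: (size (D j)) => s; clear; lia.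
pose H := \poly_(k < size B) D (k + n2)%N.
have HE k : H`_k = D (k + n2)%N.
  rewrite coef_poly; case: ltnP => // hk; rewrite /D nth_default ?div0p //.
  by rewrite (leq_trans hk) ?leq_addr.
have eB : B = H * (G2%:P * 'X^n2).
  apply/polyP => j; rewrite mulrA coefMXn coefMC; case: ltnP => hj.
    have [D0|nzD] := eqVneq (D j) 0; first by rewrite DE D0 mul0r.
    have := Dsz j nzD; have : (0 < size (D j))%N by rewrite size_poly_gt0.
    by move: hj; move: (size (D j)) => s; clear; lia.
  by rewrite HE subnK // DE.
exists H; split=> //.
  move=> k; rewrite HE; have [->|nzD] := eqVneq (D (k + n2)%N) 0.
    by rewrite size_poly0.
  by have := Dsz _ nzD; move: (size (D _)) => s; clear; lia.
have : (H * (G1%:P * 'X^n1) + C) * (G2%:P * 'X^n2) = 0.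
  by rewrite -e eB; ring.
move/eqP; rewrite mulf_eq0 [_ * 'X^_ == 0]mulf_eq0 polyC_eq0 (negPf nz2).
rewrite expf_eq0 polyX_eq0 andbF !orbF addrC addr_eq0 mulNr => /eqP ->.
by [].
Qed.

Lemma coprimep_no_common_root (G1 G2 : {poly K}) :
  (forall t, G1.[t] != 0 \/ G2.[t] != 0) -> coprimep G1 G2.
Proof.
move=> h; rewrite /coprimep; apply/negPn/negP => /closed_rootP[t].
rewrite root_gcd => /andP[/rootP r1 /rootP r2].
by case: (h t); rewrite ?r1 ?r2 eqxx.
Qed.

(** The forms q, g1, g2 without common zero behave as a regular sequence: the
quotient H of the restrictions lifts to a polynomial z, and b - z g2 and
c + z g1 restrict to 0. *)
Lemma koszul_mod_conic V q g1 g2 n1 n2 b c h :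
    q \is 2.-homog -> adapted V q ->
    g1 \is n1.-homog -> g2 \is n2.-homog -> (0 < n1)%N ->
    (forall v, v != 0 -> q.@[v 0] = 0 -> g1.@[v 0] != 0 \/ g2.@[v 0] != 0) ->
    b * g1 + c * g2 = h * q ->
  exists x y z, b = x * q + z * g2 /\ c = y * q - z * g1.
Proof.
move=> hq aV hg1 hg2 n1gt0 nocommon e; have uV := aV.1.
have cop : coprimep (restr V g1) (restr V g2).
  apply: coprimep_no_common_root => t; rewrite !horner_restr.
  by apply: nocommon; [apply: conic_point_nz | apply: meval_conic_point].
have qinf : q.@[row i2 V 0] = 0.
  by have [_ <-] := restr_dhomog V hq; rewrite restr_conic ?coef0.
have full : full_size (restr V g1) n1 \/ full_size (restr V g2) n2.
  have [] := nocommon (row i2 V) _ qinf; last 2 first.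
  - by left; apply: restr_full_size.
  - by right; apply: restr_full_size.
  apply/eqP => /(congr1 (mulmxr (invmx V))) /=.
  rewrite -row_mul mulmxV // mul0mx => /rowP/(_ i2); rewrite !mxE => /eqP.
  by rewrite oner_eq0.
(* if g2 vanished on the conic, g1 would have no zero there, but its
   restriction is a binary form of positive degree *)
have nz2 : restr V g2 != 0.
  apply/eqP => g20; case: full => [f1|]; last by rewrite /full_size g20 size_poly0.
  move: cop; rewrite g20 coprimep0 -size_poly_eq1 f1 eqSS muln_eq0 /=.
  by rewrite eqn0Ngt n1gt0.
have [H [szH eb ec]] : exists H : {poly {poly K}},
    [/\ forall k, (size (H`_k)%R <= (2 * k).+1)%N,
        grestr V b = H * grestr V g2 & grestr V c = - H * grestr V g1].
  rewrite (grestr_dhomog V hg1) (grestr_dhomog V hg2).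
  apply: (graded_syzygy cop nz2 full); do 1?exact: size_grestr_coef.
  rewrite -(grestr_dhomog V hg1) -(grestr_dhomog V hg2) -!rmorphM -rmorphD e.
  by rewrite rmorphM /= (grestr_conic aV) mulr0.
have [z ez] := grestr_surj uV szH.
have [x ex] : exists x, b - z * g2 = x * q.
  by apply: (grestr_eq0 aV); rewrite rmorphB rmorphM /= ez eb subrr.
have [y ey] : exists y, c + z * g1 = y * q.
  by apply: (grestr_eq0 aV); rewrite rmorphD rmorphM /= ez ec mulNr addNr.
by exists x, y, z; rewrite -ex -ey subrK addrK.
Qed.

End Syzygies.

(** * Derivations killing f and the gradient of f *)

Section Cross.

Variable A : comNzRingType.
Implicit Types u v w : 'rV[A]_3.

Definition dot u v := \sum_i u 0 i * v 0 i.

Definition cross u v : 'rV[A]_3 :=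
  \row_k [:: u 0 i1 * v 0 i2 - u 0 i2 * v 0 i1;
             u 0 i2 * v 0 i0 - u 0 i0 * v 0 i2;
             u 0 i0 * v 0 i1 - u 0 i1 * v 0 i0]`_k.

Lemma dotDl u u' v : dot (u + u') v = dot u v + dot u' v.
Proof.
by rewrite /dot -big_split /=; apply: eq_bigr => i _; rewrite mxE mulrDl.
Qed.

Lemma dotZl c u v : dot (c *: u) v = c * dot u v.
Proof. by rewrite /dot mulr_sumr; apply: eq_bigr => i _; rewrite mxE mulrA. Qed.

Lemma dotC u v : dot u v = dot v u.
Proof. by apply: eq_bigr => i _; rewrite mulrC. Qed.

Lemma dot_cross u v : dot (cross u v) u = 0.
Proof. by rewrite /dot sum3 !mxE /=; ring. Qed.

Lemma cross_comb (b c b' c' : A) u v :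
  cross (b *: u + c *: v) (b' *: u + c' *: v) = (b * c' - c * b') *: cross u v.
Proof. by apply/rowP; elim/all_ord3; rewrite !mxE /=; ring. Qed.

(** Both factors are orthogonal to w, so their product is a multiple of it. *)
Lemma cross_cross u v w :
  cross (cross w u) (cross w v) = dot w (cross u v) *: w.
Proof. by apply/rowP; elim/all_ord3; rewrite !mxE /= /dot sum3 !mxE /=; ring. Qed.

Lemma cross_basis (k : 'I_3) :
  exists u v, cross u v = delta_mx 0 k :> 'rV[A]_3.
Proof.
elim/all_ord3: k;
  [exists (delta_mx 0 i1), (delta_mx 0 i2)|exists (delta_mx 0 i2), (delta_mx 0 i0)
  |exists (delta_mx 0 i0), (delta_mx 0 i1)];
  by apply/rowP; elim/all_ord3; rewrite !mxE /=; ring.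
Qed.

Lemma dot_delta w k : dot w (delta_mx 0 k) = w 0 k.
Proof.
rewrite /dot (bigD1 k) //= big1 => [|j /negPf jk]; rewrite mxE !eqxx ?jk /=.
  by rewrite mulr1 addr0.
by rewrite mulr0.
Qed.

End Cross.

Definition gradient (K : fieldType) (p : {mpoly K[3]}) :
  'rV[{mpoly K[3]}]_3 := \row_i p^`M(i).

Section TwoGenerators.


Variables (K : numClosedFieldType) (f : {mpoly K[3]}).
Variables (phi1 phi2 : 'rV[{mpoly K[3]}]_3).

Lemma jacobian_syzygyE a : jacobian_syzygy f a <-> dot a (gradient f) = 0.
Proof.
by rewrite /jacobian_syzygy /dot; under [X in _ <-> X = 0]eq_bigr do rewrite mxE.
Qed.

Hypothesis span : forall a, jacobian_syzygy f a ->
  exists b c, a = b *: phi1 + c *: phi2.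

Lemma cross_syzygies a a' : jacobian_syzygy f a -> jacobian_syzygy f a' ->
  exists t, cross a a' = t *: cross phi1 phi2.
Proof.
move=> /span[b [c ->]] /span[b' [c' ->]].
by exists (b * c' - c * b'); rewrite cross_comb.
Qed.

Lemma koszul_syzygy u : jacobian_syzygy f (cross (gradient f) u).
Proof. exact/jacobian_syzygyE/dot_cross. Qed.

(** The Koszul derivations span the orthogonal complement of the gradient, so
where the gradient is nonzero phi1 and phi2 are independent. *)
Lemma koszul_minors k :
  exists t, (gradient f) 0 k *: gradient f = t *: cross phi1 phi2.
Proof.
have [u [v uv]] := cross_basis {mpoly K[3]} k.
by rewrite -dot_delta -uv -cross_cross; apply: cross_syzygies; apply: koszul_syzygy.
Qed.

(** If f were constant, the three coordinate derivations would lie in the span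
of phi1 and phi2, and all their cross products would be multiples of one
vector. *)
Lemma gradient_neq0 : exists i, f^`M(i) != 0.
Proof.
have [/existsP[i fi]|/existsPn h] := boolP [exists i, f^`M(i) != 0].
  by exists i.
have syz a : jacobian_syzygy f a.
  by rewrite /jacobian_syzygy big1 // => i _; rewrite (eqP (negPn (h i))) mulr0.
have e k : exists t, delta_mx 0 k = t *: cross phi1 phi2.
  have [u [v <-]] := cross_basis {mpoly K[3]} k; exact: cross_syzygies.
have [t0 /rowP e0] := e i0; have [t1 /rowP e1] := e i1.
have := e0 i0; have := e0 i1; have := e1 i1.
move: (cross _ _) => w; rewrite !mxE /= mulr1n mulr0n => h11 h01 h00.
have t00 : t0 = 0 by rewrite -[t0]mulr1 h11 mulrCA -h01 mulr0.
by move/eqP: h00; rewrite t00 mul0r oner_eq0.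
Qed.

Lemma minors_parallel i j (w := cross phi1 phi2) :
  w 0 i * f^`M(j) = w 0 j * f^`M(i).
Proof.
have [k nz] := gradient_neq0; have := koszul_minors k.
rewrite /w; move: (cross _ _) => {}w [t /rowP e].
apply: (mulfI nz); have := e j; have := e i; rewrite !mxE => ei ej.
by rewrite mulrCA ej [RHS]mulrCA ei; ring.
Qed.

End TwoGenerators.

Section Transversal.

Variable K : numClosedFieldType.
Variables (q f : {mpoly K[3]}) (d : nat) (V : 'M[K]_3).
Hypotheses (sq : is_smooth_conic q) (aV : adapted V q).
Hypotheses (hf : f \is d.-homog) (d_gt0 : (0 < d)%N).
Hypothesis hcard : has_card (fun P => on_curve q P /\ on_curve f P) (2 * d).
Hypothesis f_inf : f.@[row i2 V 0] != 0.

(** If the gradients are parallel at v, Euler's identity for both forms gives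
f(v) = 0, and then v is a multiple root of f along the conic. *)
Lemma conic_transversal (v : 'rV[K]_3) : v != 0 -> q.@[v 0] = 0 ->
  exists i j, (f^`M(i) * q^`M(j) - f^`M(j) * q^`M(i)).@[v 0] != 0.
Proof.
move=> nz qv; have hq := sq.1.
have [/existsP[i /existsP[j h]]|/existsPn h] := boolP [exists i, exists j,
   (f^`M(i) * q^`M(j) - f^`M(j) * q^`M(i)).@[v 0] != 0]; first by exists i, j.
have [i qi] := smooth_conic_deriv sq nz qv.
pose l := (f^`M(i)).@[v 0] / (q^`M(i)).@[v 0].
have par j : (f^`M(j)).@[v 0] = l * (q^`M(j)).@[v 0].
  have /existsPn/(_ j) := h i; rewrite negbK mevalB !mevalM subr_eq0 => /eqP e.
  by apply: (mulIf qi); rewrite -e /l; field.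
have fv : f.@[v 0] = 0.
  have := congr1 (meval (v 0)) (euler_identity hf).
  rewrite raddf_sum /= mevalMn.
  under eq_bigr => j _ do rewrite mevalM par mulrCA -mevalM.
  rewrite -mulr_sumr -raddf_sum (euler_identity hq) /= mevalMn qv mul0rn mulr0.
  by move/esym/eqP; rewrite mulrn_eq0 eqn0Ngt d_gt0 => /eqP.
have [[c ev]|[c [t [nzc ev]]]] := conic_points aV nz qv.
  move/eqP: fv; rewrite ev (meval_dhomogZ _ _ hf) mulf_eq0 (negPf f_inf) orbF.
  by rewrite expf_eq0 => /andP[_ /eqP c0]; rewrite ev c0 scale0r eqxx in nz.
have rt : root (restr V f) t.
  apply/rootP; move/eqP: fv; rewrite ev (meval_dhomogZ _ _ hf) mulf_eq0 expf_eq0.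
  by rewrite (negPf nzc) andbF /= horner_restr => /eqP.
have := simple_intersections sq aV hf d_gt0 hcard f_inf rt.
case/eqP; rewrite deriv_mmap horner_sum.
have fq j : (restr V f^`M(j)).[t] =
    l * c / c ^+ d.-1 * (restr V q^`M(j)).[t].
  have := par j; rewrite ev (meval_dhomogZ _ _ (dhomog_mderiv j hf)).
  rewrite (meval_dhomogZ _ _ (dhomog_mderiv j hq)) expr1 !horner_restr => e.
  have nzcd : c ^+ d.-1 != 0 by rewrite expf_neq0.
  apply: (mulfI nzcd); rewrite e; field.
  by rewrite nzcd.
move: (l * c / _) fq => r fq.
under eq_bigr => j _ do rewrite hornerM fq -mulrA -hornerM.
rewrite -mulr_sumr -horner_sum -deriv_mmap -/(restr V q) restr_conic //.
by rewrite deriv0 horner0 mulr0.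
Qed.

End Transversal.

(** * Minimality from the coefficients of relations *)

Section Minimality.

Variable K : fieldType.
Local Notation S := {mpoly K[3]}.
Implicit Types (r : seq 'rV[S]_3) (k : nat -> S).

(** Coefficients indexed by all of nat pass more easily to sublists than those
of [lin_comb]. *)
Definition comb r k : 'rV[S]_3 := \sum_(i < size r) k i *: r`_i.

Lemma lin_combE r (c : 'I_(size r) -> S) :
  exists k, lin_comb (r := r) c = comb r k.
Proof.
exists (fun n => if insub n is Some i then c i else 0).
by apply: eq_bigr => i _; rewrite valK.
Qed.

Lemma comb_cons a r k : comb (a :: r) k = k 0%N *: a + comb r (k \o succn).
Proof. by rewrite /comb /= big_ord_recl. Qed.

Lemma comb_mask r m k : exists k',
  comb (mask m r) k = comb r k' /\ forall i, ~~ nth false m i -> k' i = 0.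
Proof.
elim: r m k => [|a r IH] [|b m] k.
- by exists (fun=> 0); split => //; rewrite /comb !big_ord0.
- by exists (fun=> 0); split => //; rewrite /comb !big_ord0.
- exists (fun=> 0); split=> //; rewrite /comb big_ord0 big1 // => i _.
  by rewrite scale0r.
case: b => /=; [have [k' [e0 e1]] := IH m (k \o succn)|have [k' [e0 e1]] := IH m k].
  exists (fun n => if n is n'.+1 then k' n' else k 0%N).
  by split=> [|[]//]; rewrite !comb_cons e0.
exists (fun n => if n is n'.+1 then k' n' else 0).
by split=> [|[]//]; rewrite comb_cons scale0r add0r e0.
Qed.

(** If a generator is a combination of the others, it has coefficient 1 in a
relation. *)
Lemma minimal_generators_relations M r : generates M r ->
    (forall k, comb r k = 0 ->
       forall i, (i < size r)%N -> (k i).@[fun=> 0] = 0) ->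
  minimal_generators M r.
Proof.
move=> gen rel; split=> // r' /subseqP[m sz ->] [_ gen'].
have [allm|] := boolP (all id m).
  have /all_pred1P -> : all (pred1 true) m.
    by rewrite -(eq_all (a1 := id)) //; case.
  by rewrite sz mask_true.
rewrite -has_predC => /(has_nthP false) [ i ]; rewrite sz => ir /= mi.
have [c] := gen' _ (gen.1 _ (mem_nth 0 ir)).
have [k ->] := lin_combE c; have [k' [-> k'0]] := comb_mask r m k => ei.
have : comb r (fun j => (j == i)%:R - k' j) = 0.
  rewrite /comb; under eq_bigr => j _ do rewrite scalerBl.
  rewrite sumrB -/(comb r k') -ei (bigD1 (Ordinal ir)) //= eqxx scale1r.
  rewrite big1 ?addr0 ?subrr // => j /negPf.
  by rewrite -val_eqE /= => ->; rewrite scale0r.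
move=> /rel/(_ i ir); rewrite eqxx k'0 // subr0 meval1 => /eqP.
by rewrite oner_eq0.
Qed.

End Minimality.

(** * Generators of the syzygies of q f *)

(** The greatest common divisor of the r j is a constant. *)
Lemma unimodular_dvdp (K : numClosedFieldType) (p s : {poly K})
    (r : 'I_3 -> {poly K}) :
    (forall t, exists j, (r j).[t] != 0) -> (forall j, p %| s * r j) -> p %| s.
Proof.
move=> h dv; pose g := gcdp (r i0) (gcdp (r i1) (r i2)).
have g1 : g %= 1.
  rewrite -size_poly_eq1; apply/negPn/negP => /closed_rootP[t].
  rewrite !root_gcd => /and3P[/rootP r0 /rootP r1 /rootP r2].
  by have [j] := h t; elim/all_ord3: j; rewrite ?r0 ?r1 ?r2 eqxx.
rewrite -[s]mulr1 -(eqp_dvdr _ (eqp_mull s g1)) (eqp_dvdr _ (mulp_gcdr _ _ _)).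
by rewrite dvdp_gcd dv (eqp_dvdr _ (mulp_gcdr _ _ _)) dvdp_gcd !dv.
Qed.

Lemma log_comb (A : comNzRingType) (x y z p r1 r2 k : A) (a b e : 'rV[A]_3) :
  x *: (p *: a - (k * r1) *: e) + y *: (p *: b - (k * r2) *: e) +
    z *: (r2 *: a - r1 *: b) =
  (x * p + z * r2) *: a + (y * p - z * r1) *: b +
    (- (k * (x * r1 + y * r2))) *: e.
Proof. by apply/rowP => i; rewrite !mxE; ring. Qed.

Section DotDegrees.

Variable K : fieldType.
Implicit Types a u v : 'rV[{mpoly K[3]}]_3.

Lemma dhomog_dot m n u v : (forall i, u 0 i \is m.-homog) ->
  (forall i, v 0 i \is n.-homog) -> dot u v \is (m + n).-homog.
Proof. by move=> hu hv; apply: rpred_sum => i _; apply: dhomogM. Qed.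

Lemma dhomog_cross m n u v : (forall i, u 0 i \is m.-homog) ->
  (forall i, v 0 i \is n.-homog) -> forall i, cross u v 0 i \is (m + n).-homog.
Proof.
by move=> hu hv; elim/all_ord3; rewrite mxE rpredB // dhomogM.
Qed.

Lemma dhomog_gradient k (p : {mpoly K[3]}) i :
  p \is k.-homog -> gradient p 0 i \is k.-1.-homog.
Proof. by rewrite mxE; apply: dhomog_mderiv. Qed.

End DotDegrees.

Section Exponents.

Variable K : numClosedFieldType.
Variables (q f : {mpoly K[3]}) (d m1 m2 : nat) (V : 'M[K]_3).
Variables (phi1 phi2 : 'rV[{mpoly K[3]}]_3).
Hypotheses (sq : is_smooth_conic q) (aV : adapted V q).
Hypotheses (hf : f \is d.-homog) (d_gt0 : (0 < d)%N).
Hypothesis hcard : has_card (fun P => on_curve q P /\ on_curve f P) (2 * d).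
Hypothesis f_inf : f.@[row i2 V 0] != 0.
Hypotheses (syz1 : jacobian_syzygy f phi1) (syz2 : jacobian_syzygy f phi2).
Hypotheses (hphi1 : homogeneous_syzygy m1 phi1)
           (hphi2 : homogeneous_syzygy m2 phi2).
Hypothesis span : forall a, jacobian_syzygy f a ->
  exists b c, a = b *: phi1 + c *: phi2.

Let hq : q \is 2.-homog := sq.1.
Let uV : V \in unitmx := aV.1.

Lemma row_inf_neq0 : row i2 V != 0.
Proof.
apply/eqP => /(congr1 (mulmxr (invmx V))) /=.
rewrite -row_mul mulmxV // mul0mx => /rowP/(_ i2); rewrite !mxE => /eqP.
by rewrite oner_eq0.
Qed.

Lemma conic_inf : q.@[row i2 V 0] = 0.
Proof. by have [_ <-] := restr_dhomog V hq; rewrite restr_conic ?coef0. Qed.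

Lemma gradient_conic_neq0 (v : 'rV[K]_3) : v != 0 -> q.@[v 0] = 0 ->
  exists i, (f^`M(i)).@[v 0] != 0.
Proof.
move=> nz qv.
have [i [j]] := conic_transversal sq aV hf d_gt0 hcard f_inf nz qv.
have [fi|fi] := eqVneq (f^`M(i)).@[v 0] 0; last by exists i.
rewrite mevalB !mevalM fi mul0r sub0r oppr_eq0 mulf_eq0 => /norP[fj _].
by exists j.
Qed.

Local Notation w := (cross phi1 phi2).

Lemma minor_neq0 (v : 'rV[K]_3) i : (f^`M(i)).@[v 0] != 0 -> (w 0 i).@[v 0] != 0.
Proof.
have [t /rowP/(_ i)] := koszul_minors span i.
move: w => u; rewrite !mxE => e nz.
have := congr1 (meval (v 0)) e; rewrite !mevalM => e'.
apply: contraNneq nz => u0; rewrite u0 mulr0 in e'.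
by move/eqP: e'; rewrite mulf_eq0 orbb.
Qed.

(** Along the conic, the components i of the gradient and of the cross product
divide each other: the vectors are parallel and neither has a zero. If i is
chosen so that they do not vanish at infinity, their degrees are 2(d - 1) and
2(m1 + m2). *)
Lemma exponents_sum : d = (m1 + m2 + 1)%N.
Proof.
have [i fi] := gradient_conic_neq0 row_inf_neq0 conic_inf.
have wi := minor_neq0 fi.
have hfi := dhomog_mderiv i hf.
have hwi := dhomog_cross hphi1 hphi2 i.
have point t : exists i, (f^`M(i)).@[conic_point V t 0] != 0.
  by apply: gradient_conic_neq0; [apply: conic_point_nz | apply: meval_conic_point].
have par j : restr V (w 0 i) * restr V f^`M(j) = restr V (w 0 j) * restr V f^`M(i).
  by rewrite -!rmorphM minors_parallel.
have fw : restr V f^`M(i) %| restr V (w 0 i).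
  apply: (@unimodular_dvdp _ _ _ (fun j => restr V f^`M(j))).
    by move=> t; have [j fj] := point t; exists j; rewrite horner_restr.
  by move=> j; rewrite par dvdp_mull.
have wf : restr V (w 0 i) %| restr V f^`M(i).
  apply: (@unimodular_dvdp _ _ _ (fun j => restr V (w 0 j))).
    move=> t; have [j fj] := point t; exists j; rewrite horner_restr.
    exact: minor_neq0.
  by move=> j; rewrite mulrC -par dvdp_mulr.
have /eqp_size : restr V f^`M(i) %= restr V (w 0 i) by rewrite /eqp fw wf.
rewrite (restr_full_size hfi fi) (restr_full_size hwi wi).
by move: d_gt0; clear; lia.
Qed.


Local Notation S := {mpoly K[3]}.
Local Notation E := (\row_i 'X_i : 'rV[S]_3).

Lemma dot_euler k (p : S) : p \is k.-homog -> dot E (gradient p) = p *+ k.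
Proof.
by move=> /euler_identity <-; apply: eq_bigr => i _; rewrite !mxE.
Qed.

Lemma dot_gradientM a (p r : S) :
  dot a (gradient (p * r)) = dot a (gradient p) * r + p * dot a (gradient r).
Proof.
rewrite /dot mulr_suml mulr_sumr -big_split /=; apply: eq_bigr => i _.
by rewrite !mxE mderivM; ring.
Qed.

Let g1 := dot phi1 (gradient q).
Let g2 := dot phi2 (gradient q).
(** The Euler field sends q f to (d + 2) q f and f to d f; kappa and delta are
the inverses of these factors. *)
Let kappa : S := ((d + 2)%:R^-1)%:MP.
Let delta : S := (d%:R^-1)%:MP.

Lemma kappaE : kappa * (d%:R + 2) = 1.
Proof.
rewrite -natrD /kappa -mpolyC_nat -mpolyCM mulVf ?mpolyC1 //.
by rewrite pnatr_eq0 addn2.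
Qed.

Lemma deltaE : delta * d%:R = 1.
Proof.
by rewrite /delta -mpolyC_nat -mpolyCM mulVf ?mpolyC1 // pnatr_eq0 -lt0n.
Qed.

(** A derivation killing f is corrected by a multiple of the Euler field so
that it kills q * f; this needs it to send q to a multiple of q, hence the
factor q in front. *)
Definition conic_lift phi : 'rV[S]_3 :=
  q *: phi - (kappa * dot phi (gradient q)) *: E.

(** The combination of phi1 and phi2 that kills q, hence kills q * f without
any correction. *)
Definition koszul_field : 'rV[S]_3 := g2 *: phi1 - g1 *: phi2.

Local Notation psi1 := (conic_lift phi1).
Local Notation psi2 := (conic_lift phi2).
Local Notation psi3 := koszul_field.

Let dphi1 : dot phi1 (gradient f) = 0. Proof. exact/jacobian_syzygyE. Qed.
Let dphi2 : dot phi2 (gradient f) = 0. Proof. exact/jacobian_syzygyE. Qed.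

Lemma dot_comb (a b e : S) (p : S) :
  dot (a *: phi1 + b *: phi2 + e *: E) (gradient p) =
  a * dot phi1 (gradient p) + b * dot phi2 (gradient p) + e * dot E (gradient p).
Proof. by rewrite !dotDl !dotZl. Qed.

Lemma generators_comb (x y z : S) : x *: psi1 + y *: psi2 + z *: psi3 =
  (x * q + z * g2) *: phi1 + (y * q - z * g1) *: phi2 +
  (- (kappa * (x * g1 + y * g2))) *: E.
Proof. exact: log_comb. Qed.

Lemma generators_syzygy (x y z : S) :
  jacobian_syzygy (q * f) (x *: psi1 + y *: psi2 + z *: psi3).
Proof.
apply/jacobian_syzygyE; rewrite generators_comb dot_gradientM !dot_comb.
rewrite dphi1 dphi2 (dot_euler hq) (dot_euler hf) -/g1 -/g2.
transitivity (q * f * (x * g1 + y * g2) * (1 - kappa * (d%:R + 2))).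
  rewrite -[f *+ d]mulr_natr; ring.
by rewrite kappaE subrr mulr0.
Qed.

(** Otherwise every derivation killing f would be tangent to the conic at v,
among them the Koszul derivations, against transversality. *)
Lemma no_common_tangent (v : 'rV[K]_3) : v != 0 -> q.@[v 0] = 0 ->
  g1.@[v 0] != 0 \/ g2.@[v 0] != 0.
Proof.
move=> nz qv; have [e1|] := eqVneq g1.@[v 0] 0; last by left.
have [e2|] := eqVneq g2.@[v 0] 0; last by right.
have [i [j]] := conic_transversal sq aV hf d_gt0 hcard f_inf nz qv.
pose a : 'rV[S]_3 := f^`M(i) *: delta_mx 0 j + (- f^`M(j)) *: delta_mx 0 i.
have aE p : dot a (gradient p) = f^`M(i) * p^`M(j) - f^`M(j) * p^`M(i).
  rewrite dotDl !dotZl ![dot (delta_mx _ _) _]dotC !dot_delta !mxE; ring.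
have /span[b [c ea]] : jacobian_syzygy f a.
  by apply/jacobian_syzygyE; rewrite aE; ring.
rewrite -(aE q) ea dotDl !dotZl mevalD !mevalM -/g1 -/g2 e1 e2 !mulr0 addr0.
by rewrite eqxx.
Qed.

Let hg1 : g1 \is (m1 + 1).-homog.
Proof. by apply: dhomog_dot => // i; apply: (dhomog_gradient _ hq). Qed.
Let hg2 : g2 \is (m2 + 1).-homog.
Proof. by apply: dhomog_dot => // i; apply: (dhomog_gradient _ hq). Qed.

Lemma grestr_f_neq0 : grestr V f != 0.
Proof.
rewrite (grestr_dhomog V hf) mulf_neq0 ?polyC_eq0 ?expf_neq0 ?polyX_eq0 //.
exact: has_card_restr_neq0 sq aV hf d_gt0 hcard.
Qed.

Lemma f_neq0 : f != 0.
Proof. by apply: contraNneq f_inf => ->; rewrite meval0. Qed.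

Lemma q_neq0 : q != 0. Proof. exact: smooth_conic_neq0. Qed.

(** From the equation f a(q) + q a(f) = 0 and the primality of (q), the
derivation a sends q to h q and f to - h f. A multiple of the Euler field turns
it into a combination of phi1 and phi2 that preserves (q), to which
[koszul_mod_conic] applies. *)
Lemma generators_span a : jacobian_syzygy (q * f) a ->
  exists x y z, a = x *: psi1 + y *: psi2 + z *: psi3.
Proof.
move=> /jacobian_syzygyE; rewrite dot_gradientM => e.
have [h eh] : exists h, dot a (gradient q) = h * q.
  apply: (grestr_eq0 aV); apply: (mulIf grestr_f_neq0).
  have := congr1 (grestr V) e; rewrite rmorphD !rmorphM /= (grestr_conic aV).
  by rewrite !mul0r addr0 rmorph0.
have ef : dot a (gradient f) = - (h * f).
  apply: (mulfI q_neq0); apply/eqP; rewrite -subr_eq0 -e eh; apply/eqP; ring.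
have /span[b [c ea]] : jacobian_syzygy f (a + (delta * h) *: E).
  apply/jacobian_syzygyE; rewrite dotDl dotZl (dot_euler hf) ef -mulr_natr.
  transitivity (h * f * (delta * d%:R - 1)); first ring.
  by rewrite deltaE subrr mulr0.
have ebc : b * g1 + c * g2 = (h * (1 + 2 * delta)) * q.
  rewrite -!dotZl -dotDl -ea dotDl dotZl (dot_euler hq) eh; ring.
have m1_gt0 : (0 < m1 + 1)%N by rewrite addn1.
have [x [y [z [eb ec]]]] :=
  koszul_mod_conic hq aV hg1 hg2 m1_gt0 no_common_tangent ebc.
exists x, y, z; rewrite generators_comb -eb -ec -ea.
have exy : x * g1 + y * g2 = h * (1 + 2 * delta).
  apply: (mulIf q_neq0); rewrite -ebc eb ec; ring.
have -> : kappa * (x * g1 + y * g2) = delta * h.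
  transitivity (kappa * h * (delta * d%:R + 2 * delta)).
    by rewrite exy deltaE; ring.
  transitivity (kappa * (d%:R + 2) * (delta * h)); first by ring.
  by rewrite kappaE mul1r.
by rewrite scaleNr addrK.
Qed.

(** Evaluation on f removes the Euler part; then phi1 and phi2 are independent
because their cross product is nonzero, so z g1 and z g2 are multiples of q,
hence z is. *)
Lemma generators_relation (x y z : S) : x *: psi1 + y *: psi2 + z *: psi3 = 0 ->
  exists h, [/\ x = - h * g2, y = h * g1 & z = h * q].
Proof.
rewrite generators_comb => e.
have nzf := f_neq0; have nzq := q_neq0.
have e0 : kappa * (x * g1 + y * g2) = 0.
  have := congr1 (fun a => dot a (gradient f)) e.
  rewrite dot_comb dphi1 dphi2 !mulr0 !add0r (dot_euler hf).
  rewrite [RHS]big1 => [|i _]; last by rewrite mxE mul0r.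
  have /negPf nzd : d%:R != 0 :> S.
    by apply: contra_eq_neq deltaE => ->; rewrite mulr0 eq_sym oner_neq0.
  rewrite -mulr_natr => /eqP; rewrite mulf_eq0 [f * _ == 0]mulf_eq0 (negPf nzf) nzd.
  by rewrite !orbF oppr_eq0 => /eqP.
have [i wi] : exists i, w 0 i != 0.
  have [i fi] := gradient_conic_neq0 row_inf_neq0 conic_inf.
  by exists i; apply: contraNneq (minor_neq0 fi) => ->; rewrite meval0.
move: e; rewrite e0 oppr0 scale0r addr0.
move=> e; have [eb ec] : x * q + z * g2 = 0 /\ y * q - z * g1 = 0.
  move: (_ + z * g2) (_ - z * g1) e => b c e.
  have indep b' c' : b * c' - c * b' = 0.
    have := cross_comb b c b' c' phi1 phi2; rewrite e => /rowP/(_ i).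
    move: w wi => u ui; rewrite [RHS]mxE.
    rewrite [LHS](_ : _ = 0) => [/esym/eqP|].
      by rewrite mulf_eq0 (negPf ui) orbF => /eqP.
    by move: {u ui} i; elim/all_ord3; rewrite !mxE /=; ring.
  split; [have := indep 0 1|have := indep (-1) 0];
    by rewrite ?mulr0 ?mulrN1 ?mulr1 ?sub0r ?subr0 ?opprK.
have [h ez] : exists h, z = h * q.
  apply: (grestr_eq0 aV).
  have gz g y' : z * g = y' * q -> (grestr V z == 0) || (grestr V g == 0).
    move=> /(congr1 (grestr V)) /eqP.
    by rewrite !rmorphM /= (grestr_conic aV) mulr0 mulf_eq0.
  have z2 : z * g2 = - x * q by rewrite mulNr; apply/eqP; rewrite -addr_eq0 addrC eb.
  have z1 : z * g1 = y * q by apply/esym/eqP; rewrite -subr_eq0 ec.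
  have /orP[/eqP//|/eqP r1] := gz _ _ z1; have /orP[/eqP//|/eqP r2] := gz _ _ z2.
  have gnz k g : g \is k.-homog -> grestr V g = 0 -> g.@[row i2 V 0] = 0.
    move=> hg /eqP; rewrite (grestr_dhomog V hg) mulf_eq0 polyC_eq0 expf_eq0.
    rewrite polyX_eq0 andbF orbF => /eqP g0.
    by have [_ <-] := restr_dhomog V hg; rewrite g0 coef0.
  case: (no_common_tangent row_inf_neq0 conic_inf).
    by rewrite (gnz _ g1 hg1 r1) eqxx.
  by rewrite (gnz _ g2 hg2 r2) eqxx.
exists h; split=> //; apply: (mulIf nzq).
  by apply/eqP; rewrite mulNr mulNr -addr_eq0 -eb ez; apply/eqP; ring.
by apply/eqP; rewrite -subr_eq0 -ec ez; apply/eqP; ring.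
Qed.

Lemma dhomog_generators :
  [/\ homogeneous_syzygy (m1 + 2) psi1, homogeneous_syzygy (m2 + 2) psi2 &
      homogeneous_syzygy (m1 + m2 + 1) psi3].
Proof.
have kg g m i : g \is (m + 1).-homog -> kappa * g * 'X_i \is (m + 2).-homog.
  move=> hg; rewrite mul_mpolyC -scalerAl [X in X.-homog](_ : _ = m + 1 + 1)%N.
    by apply/dhomogZ/dhomogM; rewrite // dhomogX /= mdeg1.
  by rewrite -addnA.
split=> i; rewrite !mxE; apply: rpredB; rewrite ?kg //.
- by rewrite addnC dhomogM.
- by rewrite addnC dhomogM.
- by rewrite -addnA addnC dhomogM.
- by rewrite addnAC dhomogM.
Qed.

Lemma minimal_generators_conic : minimal_generators (jacobian_syzygy (q * f))
  [:: psi1; psi2; psi3].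
Proof.
have proj3 (a b c : 'rV[S]_3) : [/\ 1 *: a + 0 *: b + 0 *: c = a,
    0 *: a + 1 *: b + 0 *: c = b & 0 *: a + 0 *: b + 1 *: c = c].
  by rewrite !scale0r !scale1r !(addr0, add0r).
have combE k : comb [:: psi1; psi2; psi3] k =
    k 0%N *: psi1 + k 1%N *: psi2 + k 2%N *: psi3.
  by rewrite /comb sum3.
apply: minimal_generators_relations.
  split=> [a|a /generators_span[x [y [z ->]]]].
    rewrite !inE => /or3P[] /eqP ->.
    - by have [<- _ _] := proj3 psi1 psi2 psi3; apply: generators_syzygy.
    - by have [_ <- _] := proj3 psi1 psi2 psi3; apply: generators_syzygy.
    - by have [_ _ <-] := proj3 psi1 psi2 psi3; apply: generators_syzygy.
  exists (fun i => [:: x; y; z]`_i).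
  by rewrite -(combE (fun i => [:: x; y; z]`_i)).
have at0 k (g : S) : (0 < k)%N -> g \is k.-homog -> g.@[fun=> 0] = 0.
  move=> k0 hg; have e : g.@[(0 *: 0 : 'rV[K]_3) 0] = 0.
    by rewrite (meval_dhomogZ 0 0 hg) expr0n (gtn_eqF k0) mul0r.
  by rewrite -[RHS]e; apply: meval_eq => i; rewrite mxE mul0r.
have q0 : q.@[fun=> 0] = 0 by apply: at0 hq.
have g10 : g1.@[fun=> 0] = 0 by apply: at0 hg1; rewrite addn1.
have g20 : g2.@[fun=> 0] = 0 by apply: at0 hg2; rewrite addn1.
move=> k; rewrite combE => /generators_relation[h [e0 e1 e2]] [|[|[|//]]] _.
- by rewrite e0 mevalM g20 mulr0.
- by rewrite e1 mevalM g10 mulr0.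
- by rewrite e2 mevalM q0 mulr0.
Qed.

End Exponents.

(** * Adding a conic to an arrangement *)

Section Arrangements.

Variable K : numClosedFieldType.
Implicit Types (f q : {mpoly K[3]}) (s : seq {mpoly K[3]}).

Lemma degree_dhomog f d : f != 0 -> f \is d.-homog -> degree f = d.
Proof.
by move=> nz hf; apply: (dhomog_uniq nz _ hf); apply: (dhomog_msize hf).
Qed.

Lemma equation_dhomog s : conic_line_arrangement s ->
  equation s != 0 /\ equation s \is (degree (equation s)).-homog.
Proof.
move=> [hs _]; split.
  rewrite prodf_seq_neq0; apply/allP => g /hs[[]//|/smooth_conic_neq0 //].
rewrite -homog_msize; apply: homog_prod; apply/allP => g /hs[[_ h]|[h _]];
  exact: homogE h.
Qed.

Lemma exponents_generators f m1 m2 : exponents f [:: m1; m2] ->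
  exists phi1 phi2,
    [/\ jacobian_syzygy f phi1, jacobian_syzygy f phi2,
        homogeneous_syzygy m1 phi1, homogeneous_syzygy m2 phi2 &
        forall a, jacobian_syzygy f a ->
          exists b c, a = b *: phi1 + c *: phi2].
Proof.
move=> [_ [[|p1 [|p2 [|? ?]]] [[[mem gen] _] // _ hom]]]; exists p1, p2.
split.
- by apply: mem; rewrite mem_head.
- by apply: mem; rewrite !inE eqxx orbT.
- exact: (hom 0%N).
- exact: (hom 1%N).
- move=> a /gen[c ->]; exists (c ord0), (c (lift ord0 ord0)).
  by rewrite /lin_comb !big_ord_recl big_ord0 addr0.
Qed.

Theorem exponents_add_conic s q (m1 m2 : nat)
    (hs : conic_line_arrangement s)
    (hexp : exponents (equation s) [:: m1; m2])
    (hm1 : (1 <= m1)%N)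
    (hq : is_smooth_conic q)
    (hcard : has_card (fun P => on_curve q P /\ on_curve (equation s) P)
                      (2 * degree (equation s))%N) :
  [/\ conic_line_arrangement (q :: s),
      type2A (equation (q :: s)) &
      exponents (equation (q :: s))
        [:: (m1 + 2)%N; (m2 + 2)%N; (m1 + m2 + 1)%N]].
Proof.
have [nzf hf] := equation_dhomog hs; have [hom2 _] := hq.
have [phi1 [phi2 [syz1 syz2 hphi1 hphi2 span]]] := exponents_generators hexp.
have hm : (m1 <= m2)%N by case: hexp => /=; rewrite andbT.
have eqE : equation (q :: s) = q * equation s by rewrite /equation big_cons.
set f := equation s in nzf hf hcard syz1 syz2 span eqE *.
set d := degree f in hf hcard.
have d_gt0 : (0 < d)%N.
  rewrite lt0n; apply: contraTneq isT => d0.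
  have [ i ] := gradient_neq0 span.
  by rewrite d0 in hf; rewrite (dhomog0E hf) mderivC eqxx.
have [v [nzv qv fv]] := conic_point_off hq hf d_gt0 hcard.
(* coordinates in which the point at infinity is off the arrangement *)
have [V aV eV] := adapted_exists hom2 (fun v => @smooth_conic_deriv K q v hq) nzv qv.
rewrite -eV in fv.
have ed := exponents_sum hq aV hf d_gt0 hcard fv hphi1 hphi2 span.
have nzq := smooth_conic_neq0 hq.
have exps : exponents (q * f) [:: (m1 + 2)%N; (m2 + 2)%N; (m1 + m2 + 1)%N].
  split; first by rewrite /= !andbT; move: hm hm1; clear; lia.
  exists [:: conic_lift q d phi1; conic_lift q d phi2; koszul_field q phi1 phi2].
  split=> //.
    exact: (minimal_generators_conic hq aV hf d_gt0 hcard fv syz1 syz2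
      hphi1 hphi2 span).
  have [h1 h2 h3] := dhomog_generators d hq hphi1 hphi2.
  by case=> [|[|[|//]]] _; [exact: h1|exact: h2|exact: h3].
rewrite eqE; split=> //.
- split=> [g|[|i] [|j] //= hij].
  + by rewrite inE => /orP[/eqP -> | /hs.1 //]; right.
  (* a component equal to Q would contain a point of Q off the arrangement *)
  + move=> same; have /same : on_curve q (line_point nzv).
      exact/(on_curve_line nzv _ hom2).
    move=> /(_ v (memv_line _)) gv; move: fv; rewrite eV.
    have sj : s`_j \in s by rewrite mem_nth.
    rewrite /f /equation (big_rem _ sj) /= mevalM gv mul0r eqxx //.
  + exact: hs.2.
- split; last by exists [:: (m1 + 2)%N; (m2 + 2)%N; (m1 + m2 + 1)%N].
  exists [:: (m1 + 2)%N; (m2 + 2)%N; (m1 + m2 + 1)%N]; split=> //=.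
  rewrite (degree_dhomog _ (dhomogM hom2 hf)) ?mulf_neq0 // ed.
  by clear; lia.
Qed.

End Arrangements.

Theorem theorem1p16 (R : realType) (s : seq {mpoly R[i][3]})
    (q : {mpoly R[i][3]}) (m1 m2 : nat)
    (hs : conic_line_arrangement s)
    (hfree : free_curve (equation s))
    (hexp : exponents (equation s) [:: m1; m2])
    (hm1 : (2 <= m1)%N)
    (hq : is_smooth_conic q)
    (hcard : has_card (fun P => on_curve q P /\ on_curve (equation s) P)
                      (2 * degree (equation s))%N) :
  [/\ conic_line_arrangement (q :: s),
      type2A (equation (q :: s)) &
      exponents (equation (q :: s))
        [:: (m1 + 2)%N; (m2 + 2)%N; (m1 + m2 + 1)%N]].
Proof. exact: exponents_add_conic hs hexp (ltnW hm1) hq hcard. Qed.
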